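(* Let $\lambda$, $\mathbf{a}=(a_\ell)_{\ell\ge0}$, $\mathbf{b}=(b_{\ell,\ell'})$, $\mathbf{c}=(c_{\ell,\ell'})$, $\mathbf{d}=(d_{\ell,\ell'})$ ($\ell,\ell'\ge0$), $\mathbf{e}=(e_\ell)$, $\mathbf{f}=(f_\ell)$ be commuting indeterminates. For $n\ge0$ let \[ \widehat{Q}'_n=\sum_{\sigma\in\mathfrak{D}_{2n}}\lambda^{\mathrm{cyc}(\sigma)}\prod_{i\in\mathrm{Cval}}a_{\mathrm{lcross}'(i,\sigma)+\mathrm{lnest}'(i,\sigma)}\prod_{i\in\mathrm{Cpeak}}b_{\mathrm{ucross}'(i,\sigma),\mathrm{unest}'(i,\sigma)}\prod_{i\in\mathrm{Cdfall}}c_{\mathrm{lcross}'(i,\sigma),\mathrm{lnest}'(i,\sigma)}\prod_{i\in\mathrm{Cdrise}}d_{\mathrm{ucross}'(i,\sigma),\mathrm{unest}'(i,\sigma)}\prod_{i\in\mathrm{Evenfix}}e_{\mathrm{psnest}(i,\sigma)}\prod_{i\in\mathrm{Oddfix}}f_{\mathrm{psnest}(i,\sigma)} \] and \[ \widehat{Q}_n=\sum_{\sigma\in\mathfrak{D}_{2n}}\lambda^{\mathrm{cyc}(\sigma)}\prod_{i\in\mathrm{Cval}}a_{\mathrm{ucross}(i,\sigma)+\mathrm{unest}(i,\sigma)}\prod_{i\in\mathrm{Cpeak}}b_{\mathrm{lcross}(i,\sigma),\mathrm{lnest}(i,\sigma)}\prod_{i\in\mathrm{Cdfall}}c_{\mathrm{lcross}(i,\sigma),\mathrm{lnest}(i,\sigma)}\prod_{i\in\mathrm{Cdrise}}d_{\mathrm{ucross}(i,\sigma),\mathrm{unest}(i,\sigma)}\prod_{i\in\mathrm{Evenfix}}e_{\mathrm{psnest}(i,\sigma)}\prod_{i\in\mathrm{Oddfix}}f_{\mathrm{psnest}(i,\sigma)}.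 \] Then \[ \sum_{n\ge0}\widehat{Q}'_nt^n=\cfrac{1}{1-\delta_1t-\cfrac{\alpha_1t}{1-\delta_2t-\cfrac{\alpha_2t}{1-\cdots}}} \] with, for $k\ge1$, $\alpha_{2k-1}=(\lambda+k-1)a_{k-1}\sum_{\xi=0}^{k-1}b_{k-1-\xi,\xi}$, $\alpha_{2k}=\big(\lambda e_k+\sum_{\xi=0}^{k-1}c_{k-1-\xi,\xi}\big)\big(\lambda f_k+\sum_{\xi=0}^{k-1}d_{k-1-\xi,\xi}\big)$, $\delta_1=\lambda^2e_0f_0$, $\delta_n=0$ for $n\ge2$ (the same T-fraction as for $\widehat{Q}_n$), and therefore $\widehat{Q}'_n=\widehat{Q}_n$ for all $n\ge0$.
   Context: A D-permutation of $[2n]$: $\sigma(2k-1)\ge2k-1$ and $\sigma(2k)\le2k$ for all $k$; $\mathfrak{D}_{2n}$ is their set. $\mathrm{Cpeak}=\{i:\sigma^{-1}(i)<i>\sigma(i)\}$, $\mathrm{Cval}=\{i:\sigma^{-1}(i)>i<\sigma(i)\}$, $\mathrm{Cdrise}=\{i:\sigma^{-1}(i)<i<\sigma(i)\}$, $\mathrm{Cdfall}=\{i:\sigma^{-1}(i)>i>\sigma(i)\}$, $\mathrm{Evenfix}$/$\mathrm{Oddfix}$ = even/odd fixed points. $\mathrm{cyc}$ = number of cycles. $\mathrm{ucross}(j,\sigma)=\#\{i<j<k<l:k=\sigma(i),l=\sigma(j)\}$, $\mathrm{unest}(j,\sigma)=\#\{i<j<k<l:k=\sigma(j),l=\sigma(i)\}$,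 $\mathrm{lcross}(k,\sigma)=\#\{i<j<k<l:i=\sigma(k),j=\sigma(l)\}$, $\mathrm{lnest}(k,\sigma)=\#\{i<j<k<l:i=\sigma(l),j=\sigma(k)\}$; $\mathrm{ucross}'(k,\sigma)=\#\{i<j<k<l:k=\sigma(i),l=\sigma(j)\}$, $\mathrm{unest}'(k,\sigma)=\#\{i<j<k<l:k=\sigma(j),l=\sigma(i)\}$, $\mathrm{lcross}'(j,\sigma)=\#\{i<j<k<l:i=\sigma(k),j=\sigma(l)\}$, $\mathrm{lnest}'(j,\sigma)=\#\{i<j<k<l:i=\sigma(l),j=\sigma(k)\}$ (each counts choices of the remaining three indices). For a fixed point $i$, $\mathrm{psnest}(i,\sigma)=\#\{j<i:\sigma(j)>i\}$. *)

(* Defs.v *)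
From mathcomp Require Import all_boot all_order all_fingroup all_algebra.

Set Implicit Arguments.
Unset Strict Implicit.
Unset Printing Implicit Defensive.

Import GRing.Theory.

(* The letter m of [2n] = {1, ..., 2n} is encoded by the ordinal of value m - 1
   in 'I_(2 * n), so parity is read off [label], while order comparisons can be
   made directly on ordinals. *)
Definition label (N : nat) (i : 'I_N) : nat := i.+1.

Definition Dperm (n : nat) : {set 'S_(2 * n)} :=
  [set s : 'S_(2 * n) |
    [forall i : 'I_(2 * n), if odd (label i) then i <= s i else s i <= i]].

Definition cyc (N : nat) (s : 'S_N) : nat := #|porbits s|.

Section Statistics.
Variables (N : nat) (s : 'S_N).

Definition Cpeak : {set 'I_N} := [set i : 'I_N | (s^-1%g i < i) && (s i < i)].
Definition Cval : {set 'I_N} := [set i : 'I_N | (i < s^-1%g i) && (i < s i)].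
Definition Cdrise : {set 'I_N} := [set i : 'I_N | (s^-1%g i < i) && (i < s i)].
Definition Cdfall : {set 'I_N} := [set i : 'I_N | (i < s^-1%g i) && (s i < i)].
Definition Evenfix : {set 'I_N} := [set i : 'I_N | (s i == i) && ~~ odd (label i)].
Definition Oddfix : {set 'I_N} := [set i : 'I_N | (s i == i) && odd (label i)].

Definition upper_cross (i j k l : 'I_N) : bool :=
  [&& i < j, j < k, k < l, k == s i & l == s j].
Definition upper_nest (i j k l : 'I_N) : bool :=
  [&& i < j, j < k, k < l, k == s j & l == s i].
Definition lower_cross (i j k l : 'I_N) : bool :=
  [&& i < j, j < k, k < l, i == s k & j == s l].
Definition lower_nest (i j k l : 'I_N) : bool :=
  [&& i < j, j < k, k < l, i == s l & j == s k].

(* Number of quadruples (i, j, k, l) satisfying q whose second (resp. third)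
   entry is prescribed. *)
Definition count2 (q : 'I_N -> 'I_N -> 'I_N -> 'I_N -> bool) (j : 'I_N) : nat :=
  #|[set t : 'I_N * 'I_N * 'I_N | q t.1.1 j t.1.2 t.2]|.
Definition count3 (q : 'I_N -> 'I_N -> 'I_N -> 'I_N -> bool) (k : 'I_N) : nat :=
  #|[set t : 'I_N * 'I_N * 'I_N | q t.1.1 t.1.2 k t.2]|.

Definition ucross : 'I_N -> nat := count2 upper_cross.
Definition unest : 'I_N -> nat := count2 upper_nest.
Definition lcross : 'I_N -> nat := count3 lower_cross.
Definition lnest : 'I_N -> nat := count3 lower_nest.

Definition ucross' : 'I_N -> nat := count3 upper_cross.
Definition unest' : 'I_N -> nat := count3 upper_nest.
Definition lcross' : 'I_N -> nat := count2 lower_cross.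
Definition lnest' : 'I_N -> nat := count2 lower_nest.

Definition psnest (i : 'I_N) : nat := #|[set j : 'I_N | (j < i) && (i < s j)]|.

End Statistics.

Local Open Scope ring_scope.

Section Polynomials.
Variables (R : comNzRingType) (lam : R) (a : nat -> R).
Variables (b c d : nat -> nat -> R) (e f : nat -> R).

Definition Qhat' (n : nat) : R :=
  \sum_(s in Dperm n)
    lam ^+ cyc s
    * (\prod_(i in Cval s) a (lcross' s i + lnest' s i)%N)
    * (\prod_(i in Cpeak s) b (ucross' s i) (unest' s i))
    * (\prod_(i in Cdfall s) c (lcross' s i) (lnest' s i))
    * (\prod_(i in Cdrise s) d (ucross' s i) (unest' s i))
    * (\prod_(i in Evenfix s) e (psnest s i))
    * (\prod_(i in Oddfix s) f (psnest s i)).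

Definition Qhat (n : nat) : R :=
  \sum_(s in Dperm n)
    lam ^+ cyc s
    * (\prod_(i in Cval s) a (ucross s i + unest s i)%N)
    * (\prod_(i in Cpeak s) b (lcross s i) (lnest s i))
    * (\prod_(i in Cdfall s) c (lcross s i) (lnest s i))
    * (\prod_(i in Cdrise s) d (ucross s i) (unest s i))
    * (\prod_(i in Evenfix s) e (psnest s i))
    * (\prod_(i in Oddfix s) f (psnest s i)).

End Polynomials.

(* A formal power series in t is represented by its coefficient sequence. *)
Section FormalPowerSeries.
Variable R : comNzRingType.
Implicit Types f g : nat -> R.

Definition fps_mul f g (n : nat) : R := \sum_(i < n.+1) f i * g (n - i)%N.

Definition fps_mulX f (n : nat) : R := if n is m.+1 then f m else 0.

(* [fps_inv_rev f n] is [:: g_n; ...; g_0], where g_0 = 1 and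
   g_(m+1) = - (f_1 g_m + ... + f_(m+1) g_0); this g is the inverse of f
   when f_0 = 1, see [fps_mulV]. *)
Fixpoint fps_inv_rev f (n : nat) : seq R :=
  if n is m.+1 then
    let g := fps_inv_rev f m in (- \sum_(i < m.+1) f i.+1 * g`_i) :: g
  else [:: 1].

Definition fps_inv f (n : nat) : R := head 0 (fps_inv_rev f n).

Lemma nth_fps_inv_rev f n i :
  (i <= n)%N -> (fps_inv_rev f n)`_i = fps_inv f (n - i)%N.
Proof.
elim: n i => [|n IHn] [|i] //= le_in.
by rewrite subSS IHn.
Qed.

Lemma fps_mulV f n : f 0%N = 1 -> fps_mul f (fps_inv f) n = (n == 0%N)%:R.
Proof.
rewrite /fps_mul => f0; case: n => [|n].
  by rewrite big_ord1 f0 mul1r.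
rewrite big_ord_recl f0 mul1r subn0 {1}/fps_inv /=.
rewrite (eq_bigr (fun i : 'I_n.+1 => f i.+1 * fps_inv f (n - i)%N)).
  by rewrite /bump /= addNr.
by move=> i _; rewrite nth_fps_inv_rev // -ltnS.
Qed.

Variables delta alpha : nat -> R.

(* The K-level truncation of
     1 / (1 - delta_m t - alpha_m t / (1 - delta_(m+1) t - ...)),
   obtained by setting alpha_(m+K-1) to 0. *)
Fixpoint Tfrac_trunc (K m : nat) : nat -> R :=
  if K is K'.+1 then
    fps_inv (fun n => (n == 0%N)%:R - delta m * (n == 1%N)%:R
                      - alpha m * fps_mulX (Tfrac_trunc K' m.+1) n)
  else fun=> 0.

(* f is the formal power series defined by the infinite T-fraction with
   coefficients (delta_m, alpha_m), m >= 1: the truncations converge to f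
   coefficientwise, i.e. for the t-adic topology. *)
Definition is_Tfrac f : Prop :=
  forall n : nat, exists K0 : nat,
    forall K : nat, (K0 <= K)%N -> Tfrac_trunc K 1 n = f n.

End FormalPowerSeries.

(* Main.v *)
Require Import Defs.
From mathcomp Require Import all_boot all_order all_fingroup all_algebra.
From mathcomp Require Import zify ring.

(* Fix the type (cycle valley, cycle peak, ...) of every vertex, and build the
   permutation by drawing first the lower arcs, by increasing source, and then
   the upper arcs, by decreasing source.  Missing arcs are completed by closing
   every path of the partial functional digraph into a cycle, so that a partial
   permutation is again a permutation and drawing an arc multiplies it by a
   transposition.  At every step the target is an arbitrary open one, and its
   rank among the open targets is the pair (cross, nest) of the source.  No
   lower arc and no arc leaving a cycle double rise closes a cycle, while for a
   cycle valley with h + 1 open targets exactly one does; this gives the factor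
   lambda + h.  Summing over the types gives weighted Motzkin paths of length
   2n, which contract to the T-fraction.  Inversion of permutations exchanges
   the two families of statistics, up to swapping c and d, without changing the
   weights of pairs of steps. *)

Set Implicit Arguments.
Unset Strict Implicit.
Unset Printing Implicit Defensive.

Import GRing.Theory.

(* [None] is the type of a fixed point and [Some (u, q)] that of a vertex v with
   u = (v < s v) and q = (v < s^-1 v).  In the names below, u/l stands for the
   upper/lower arcs, and s/t for the source/target of an arc. *)
Definition vtype : finType := option (bool * bool).

Definition is_us (t : vtype) : bool := if t is Some (u, _) then u else false.
Definition is_ls (t : vtype) : bool := if t is Some (u, _) then ~~ u else false.
Definition is_ut (t : vtype) : bool := if t is Some (_, q) then ~~ q else false.
Definition is_lt (t : vtype) : bool := if t is Some (_, q) then q else false.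
Definition is_val (t : vtype) : bool := is_us t && is_lt t.
Definition is_peak (t : vtype) : bool := is_ls t && is_ut t.

(** * Partial permutations with prescribed vertex types *)

Section Extensions.
Variable N : nat.
Implicit Types (s p : 'S_N) (w : 'I_N -> vtype) (v x z : 'I_N) (D : {set 'I_N}).

Definition vtyp s v : vtype :=
  if s v == v then None else Some (v < s v, v < s^-1%g v).

Definition arrow w v x : bool :=
  match w v, w x with
  | Some (u, _), Some (_, q) => [&& v != x, u == (v < x) & q == (x < v)]
  | None, None => v == x
  | _, _ => false
  end.

Lemma ord_neq_ltn v x : v != x -> (v < x) = ~~ (x < v).
Proof. by move=> ne; rewrite -leqNgt ltn_neqAle ne. Qed.

Lemma arrow_us w v x : is_us (w v) -> arrow w v x = is_ut (w x) && (v < x).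
Proof.
rewrite /arrow; case: (w v) => [[[] q]|] //= _; case: (w x) => [[u' q']|] //=.
case: (eqVneq v x) => [->|ne] /=; first by rewrite ltnn andbF.
by rewrite (ord_neq_ltn ne); case: q'; case: (x < v).
Qed.

Lemma arrow_ls w v x : is_ls (w v) -> arrow w v x = is_lt (w x) && (x < v).
Proof.
rewrite /arrow; case: (w v) => [[[] q]|] //= _; case: (w x) => [[u' q']|] //=.
case: (eqVneq v x) => [->|ne] /=; first by rewrite ltnn andbF.
by rewrite (ord_neq_ltn ne); case: q'; case: (x < v).
Qed.

Lemma arrow_fix w v x : w v = None -> arrow w v x = (v == x).
Proof.
move=> wv; rewrite /arrow wv; case wx: (w x) => [[u q]|] //.
by apply/esym; apply: contra_eqF wv => /eqP ->; rewrite wx.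
Qed.

(** The arc leaving [v] decides the outgoing half of the type of [v] and the incoming half of the
    type of [s v]; over all arcs, both halves of every type are covered. The condition on types thus
    becomes local to arcs. *)
Lemma vtypP s w : reflect (forall v, arrow w v (s v)) [forall v, vtyp s v == w v].
Proof.
apply: (iffP forallP) => [tw v|aw v].
  rewrite /arrow -(eqP (tw v)) -(eqP (tw (s v))) /vtyp permK (inj_eq perm_inj).
  by rewrite (eq_sym v); case: eqP => //= _; rewrite !eqxx.
have := aw v; have := aw (s^-1 v)%g; rewrite permKV /vtyp.
case wv: (w v) => [[u q]|]; last by rewrite (arrow_fix _ wv) eq_sym => _ ->.
rewrite /arrow wv; case: (w (s v)) => [[u' q']|] //=.
case: (w (s^-1 v)%g) => [[u'' q'']|] //=.
by move=> /and3P[_ _ /eqP->] /and3P[]; rewrite eq_sym => /negbTE-> /eqP-> _.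
Qed.

(** [D] holds the sources whose arc is still undrawn; the values of [p] on [D] only close up the
    open paths and do not bind [s]. *)
Definition ext w p D : pred 'S_N :=
  fun s => [forall v, arrow w v (s v)] && [forall v, (v \notin D) ==> (s v == p v)].

Lemma extP w p D s :
  reflect ((forall v, arrow w v (s v)) /\ (forall v, v \notin D -> s v = p v))
          (ext w p D s).
Proof.
apply: (iffP andP) => [[/forallP aw /forallP sp]|[aw sp]]; split => //.
- by move=> v nv; apply/eqP; have := sp v; rewrite nv.
- exact/forallP.
- by apply/forallP=> v; apply/implyP=> /sp ->.
Qed.

(* [tperm v z * p] redirects v to p z and z to p v: if the cycles of v and z in
   p are closed-up paths ending in v and z, it draws the arc v -> p z and closes
   the resulting longer path. *)
Lemma graft_out p v z : (tperm v z * p)%g v = p z.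
Proof. by rewrite permM tpermL. Qed.

Lemma graft_end p v z : (tperm v z * p)%g z = p v.
Proof. by rewrite permM tpermR. Qed.

Lemma graft_other p v z x : x != v -> x != z -> (tperm v z * p)%g x = p x.
Proof. by move=> xv xz; rewrite permM tpermD // eq_sym. Qed.

(** The graft alters [p] only at [v] and [z], and [z] stays unconstrained unless it is [v], so the
    only new constraint is the value at [v]. *)
Lemma ext_graft w p D v z s : v \in D -> z \in D ->
  ext w (tperm v z * p)%g (D :\ v) s = ext w p D s && (s v == p z).
Proof.
move=> vD zD; apply/extP/andP => [[aw sp]|[/extP[aw sp] /eqP svz]]; split => //.
- apply/extP; split=> // x nx.
  rewrite sp ?inE ?(negbTE nx) ?andbF // graft_other //.
    by apply: contraNneq nx => ->.
  by apply: contraNneq nx => ->.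
- by rewrite sp ?graft_out // !inE eqxx.
- move=> x; rewrite !inE negb_and negbK.
  have [->|nxv /= nx] := eqVneq x v; first by rewrite graft_out.
  rewrite graft_other ?sp //.
  by apply: contraNneq nx => ->.
Qed.

Lemma ext_step (R : nmodType) w p D v (F : 'S_N -> R) : v \in D ->
  (\sum_(s | ext w p D s) F s =
   \sum_(z | (z \in D) && arrow w v (p z))
     \sum_(s | ext w (tperm v z * p)%g (D :\ v) s) F s)%R.
Proof.
move=> vD.
rewrite (partition_big (fun s : 'S_N => (p^-1 (s v))%g)
  (fun z => (z \in D) && arrow w v (p z))) /=.
  apply: eq_bigr => z /andP[zD _]; apply: eq_bigl => s.
  rewrite ext_graft //; congr (_ && _).
  by rewrite (can2_eq (permKV p) (permK p)).
move=> s /extP[aw sp]; rewrite permKV aw andbT.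
(* Outside [D], [s z = p z = s v] would force [z = v], which lies in [D]. *)
apply/negPn/negP => nz; have := sp _ nz; rewrite permKV => /perm_inj zv.
by rewrite zv vD in nz.
Qed.

(* [r] sends a vertex to the end of its path, so that distinct path ends, i.e.
   sources not yet used, lie in distinct cycles of [p]. *)
Definition valid w p D :=
  (forall v, v \notin D -> arrow w v (p v)) /\
  (exists r : 'I_N -> 'I_N, (forall x, r (p x) = r x) /\ {in D, forall x, r x = x}).

(** The path ending in [v] is continued by the one ending in [z], so all its vertices now end in
    [z]. *)
Lemma valid_graft w p D v z : valid w p D -> v \in D -> z \in D ->
  arrow w v (p z) -> valid w (tperm v z * p)%g (D :\ v).
Proof.
move=> [ap [r [rp rD]]] vD zD avz; split.
  move=> x; rewrite !inE negb_and negbK.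
  have [->|nxv /= nx] := eqVneq x v; first by rewrite graft_out.
  rewrite graft_other ?ap //.
  by apply: contraNneq nx => ->.
exists (fun x => if r x == v then z else r x); split; last first.
  by move=> x /setD1P[nxv xD]; rewrite rD // (negbTE nxv).
have rv := rD v vD; have rz := rD z zD.
move=> x; have [->|nxv] := eqVneq x v.
  by rewrite graft_out rp rv rz eqxx if_same.
have [->|nxz] := eqVneq x z.
  by rewrite graft_end rp rv rz eqxx if_same.
by rewrite graft_other // rp.
Qed.

(** Distinct elements of [D] lie in distinct cycles, which the transposition merges. For [v = z] the
    permutation is unchanged, but the closed-up path of [v] becomes a final cycle. *)
Lemma cyc_graft w p D v z : valid w p D -> v \in D -> z \in D ->
  cyc (tperm v z * p)%g + (v != z) = cyc p.
Proof.
move=> [_ [r [rp rD]]] vD zD; have := porbits_mul_tperm p v z; rewrite /cyc /=.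
have [->|nvz] /= := eqVneq v z; first by rewrite porbit_id addn0 addn0.
suff -> : v \notin porbit p z by rewrite /= addn2 addn1 => -[]; rewrite addn1.
apply/negP => /porbitP[i vi].
have rX x : r ((p ^+ i)%g x) = r x.
  by elim: i {vi} x => [|i IH] x; rewrite ?expg0 ?perm1 // expgS permM IH rp.
by move: nvz; rewrite -(rD v vD) vi rX rD // eqxx.
Qed.

End Extensions.

(** * Sums over a finite set by rank *)

Section RankSums.
Variables (R : nmodType) (N : nat).
Implicit Types O : {set 'I_N}.
Local Open Scope ring_scope.

(** Each rank is taken once. The induction removes the maximum, which gives the last term and counts
    as one larger element for all the others. *)
Lemma sum_rank O (F : nat -> nat -> R) :
  \sum_(l in O) F #|[set t in O | (t < l)%N]| #|[set t in O | (l < t)%N]| =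
  \sum_(xi < #|O|) F xi (#|O| - 1 - xi)%N.
Proof.
have [n leO] := ubnP #|O|; elim: n => // n IHn in O F leO *.
have [->|[x xO]] := set_0Vmem O; first by rewrite big_set0 cards0 big_ord0.
have [m mO maxm] : {m | m \in O & forall t, t \in O -> (t <= m)%N}.
  by case: (arg_maxnP (fun t : 'I_N => t : nat) xO) => m; exists m.
have cO : #|O| = #|O :\ m|.+1 by rewrite (cardsD1 m) mO add1n.
rewrite cO big_ord_recr /= (bigD1 m) //= addrC; congr (_ + _); last first.
  have -> : [set t in O | (t < m)%N] = O :\ m.
    apply/setP=> t; rewrite !inE andbC ltn_neqAle.
    by case tO: (t \in O); rewrite ?andbF // maxm // andbT.
  suff -> : [set t in O | (m < t)%N] = set0 by rewrite cards0; congr F; lia.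
  apply/setP=> t; rewrite !inE.
  by case tO: (t \in O); rewrite //= ltnNge maxm.
rewrite (eq_bigl (mem (O :\ m))); last by move=> l; rewrite !inE andbC.
transitivity (\sum_(l in O :\ m)
   F #|[set t in O :\ m | (t < l)%N]| #|[set t in O :\ m | (l < t)%N]|.+1).
  apply: eq_bigr => l /setD1P[nlm lO].
  have llm : (l < m)%N by rewrite ltn_neqAle nlm maxm.
  congr F.
    apply: eq_card => t; rewrite !inE.
    by have [->|] := eqVneq t m; rewrite //= ltnNge ltnW ?andbF.
  rewrite [LHS](cardsD1 m) inE mO llm add1n; congr _.+1; apply: eq_card => t.
  by rewrite !inE andbA.
rewrite (IHn _ (fun i j => F i j.+1)); last by rewrite -ltnS -cO.
apply: eq_bigr => i _; congr F.
by rewrite [in RHS]subn1 /= subnAC subn1 prednK ?subn_gt0.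
Qed.

Lemma sum_rank_rev O (F : nat -> nat -> R) :
  \sum_(l in O) F #|[set t in O | (t < l)%N]| #|[set t in O | (l < t)%N]| =
  \sum_(xi < #|O|) F (#|O| - 1 - xi)%N xi.
Proof.
rewrite sum_rank (reindex_inj rev_ord_inj) /=.
apply: eq_bigr => i _; have lti := ltn_ord i.
have -> : (#|O| - i.+1 = #|O| - 1 - i)%N by rewrite -subnDA.
by rewrite subKn // subn1 -ltnS prednK // (leq_ltn_trans _ lti).

Qed.

End RankSums.

(** * Crossings and nestings counted by targets *)

Section StatisticsByTarget.
Variables (N : nat) (s : 'S_N).

(** With [j] given, the quadruple is determined by the target [t] of the other arc. This form
    compares directly with the open targets of the construction. *)
Lemma ucrossE (j : 'I_N) :
  ucross s j = #|[set t : 'I_N | [&& j < t, t < s j & s^-1%g t < j]]|.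
Proof.
rewrite -(card_imset _ (f := fun t => (s^-1%g t, t, s j))); last by move=> x y [].
apply: eq_card => -[[i k] l]; rewrite inE /upper_cross /=; apply/idP/imsetP.
  move=> /and5P[ij jk kl /eqP ek /eqP el]; exists k; last by rewrite el ek permK.
  by rewrite inE -el jk kl ek permK.
by move=> [t + [-> -> ->]]; rewrite inE permKV !eqxx => /and3P[-> -> ->].
Qed.

Lemma unestE (j : 'I_N) :
  unest s j = #|[set t : 'I_N | [&& j < s j, s j < t & s^-1%g t < j]]|.
Proof.
rewrite -(card_imset _ (f := fun t => (s^-1%g t, s j, t))); last by move=> x y [].
apply: eq_card => -[[i k] l]; rewrite inE /upper_nest /=; apply/idP/imsetP.
  move=> /and5P[ij jk kl /eqP ek /eqP el]; exists l; last by rewrite el ek permK.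
  by rewrite inE -ek jk kl el permK.
by move=> [t + [-> -> ->]]; rewrite inE permKV !eqxx => /and3P[-> -> ->].
Qed.

Lemma lcrossE (k : 'I_N) :
  lcross s k = #|[set t : 'I_N | [&& s k < t, t < k & k < s^-1%g t]]|.
Proof.
rewrite -(card_imset _ (f := fun t => (s k, t, s^-1%g t))); last by move=> x y [].
apply: eq_card => -[[i j] l]; rewrite inE /lower_cross /=; apply/idP/imsetP.
  move=> /and5P[ij jk kl /eqP ei /eqP ej]; exists j; last by rewrite ei ej permK.
  by rewrite inE -ei ij jk ej permK.
by move=> [t + [-> -> ->]]; rewrite inE permKV !eqxx => /and3P[-> -> ->].
Qed.

Lemma lnestE (k : 'I_N) :
  lnest s k = #|[set t : 'I_N | [&& t < s k, s k < k & k < s^-1%g t]]|.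
Proof.
rewrite -(card_imset _ (f := fun t => (t, s k, s^-1%g t))); last by move=> x y [].
apply: eq_card => -[[i j] l]; rewrite inE /lower_nest /=; apply/idP/imsetP.
  move=> /and5P[ij jk kl /eqP ei /eqP ej]; exists i; last by rewrite ej ei permK.
  by rewrite inE -ej ij jk ei permK.
by move=> [t + [-> -> ->]]; rewrite inE permKV !eqxx => /and3P[-> -> ->].
Qed.

End StatisticsByTarget.

(** * Drawing the upper arcs *)

Section UpperArcs.
Variables (R : comNzRingType) (lam : R) (d : nat -> nat -> R).
Variables (N : nat) (w : 'I_N -> vtype).
Implicit Types (s p : 'S_N) (v x z t : 'I_N) (D : {set 'I_N}).

Lemma arrow_ut v x : is_ut (w x) -> arrow w v x = is_us (w v) && (v < x).
Proof.
rewrite /arrow; case: (w x) => [[u []]|] //= _; case: (w v) => [[u' q']|] //=.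
case: (eqVneq v x) => [->|ne] /=; first by rewrite ltnn andbF.
by rewrite (ord_neq_ltn ne); case: u'; case: (x < v).
Qed.

Lemma arrow_lt v x : is_lt (w x) -> arrow w v x = is_ls (w v) && (x < v).
Proof.
rewrite /arrow; case: (w x) => [[u []]|] //= _; case: (w v) => [[u' q']|] //=.
case: (eqVneq v x) => [->|ne] /=; first by rewrite ltnn andbF.
by rewrite (ord_neq_ltn ne); case: u'; case: (x < v).
Qed.

Lemma arrow_up v x : arrow w v x -> v < x -> is_us (w v) && is_ut (w x).
Proof.
rewrite /arrow; case: (w x) => [[u q]|]; case: (w v) => [[u' q']|] //=.
  by move=> /and3P[_ /eqP-> /eqP->] vx; rewrite vx ltnNge ltnW.
by move=> /eqP->; rewrite ltnn.
Qed.

Lemma arrow_down v x : arrow w v x -> x < v -> is_ls (w v) && is_lt (w x).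
Proof.
rewrite /arrow; case: (w x) => [[u q]|]; case: (w v) => [[u' q']|] //=.
  by move=> /and3P[_ /eqP-> /eqP->] vx; rewrite vx ltnNge ltnW.
by move=> /eqP->; rewrite ltnn.
Qed.

(** The two permutations agree outside [D], hence take the same set of values on [D]. *)
Lemma ext_open p D s t : ext w p D s -> (s^-1%g t \in D) = (p^-1%g t \in D).
Proof.
move=> /extP[_ sp]; apply/idP/idP; apply: contraTT => nD.
  suff -> : (s^-1 t = p^-1 t)%g by [].
  by apply: (canLR (permK s)); rewrite sp // permKV.
suff -> : (p^-1 t = s^-1 t)%g by [].
by apply: (canLR (permK p)); rewrite -sp // permKV.
Qed.

Lemma ext0 p s : (forall v, arrow w v (p v)) -> ext w p set0 s = (s == p).
Proof.
move=> ap; apply/extP/eqP => [[_ sp]|->]; last by [].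
by apply/permP => v; rewrite sp // inE.
Qed.

Definition up_srcs (m : nat) : {set 'I_N} := [set v : 'I_N | is_us (w v) && (v < m)].

Definition up_height v : nat :=
  #|[set x | is_ut (w x) && (v < x)]| - #|[set x | is_us (w x) && (v < x)]|.

(** A valley has weight 1 here: its own weight depends on [w] alone and enters in [word_sum]. *)
Definition up_wt s v : R :=
  if is_lt (w v) then 1%R else d (ucross s v) (unest s v).

Definition up_fac v : R :=
  if is_lt (w v) then (lam + (up_height v)%:R - 1)%R
  else (\sum_(xi < up_height v) d (up_height v - 1 - xi) xi)%R.

Definition up_open p v := [set t : 'I_N | (v < t) && (p^-1%g t \in up_srcs v.+1)].

(** An upper target above [v] is either open or the image of an upper source above [v], whose arc is
    already drawn. *)
Lemma card_up_open p v : valid w p (up_srcs v.+1) ->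
  {in up_srcs v.+1, forall x, is_ut (w (p x))} -> #|up_open p v| = up_height v.
Proof.
move=> [ap _] utp; rewrite /up_height.
rewrite -(cardsID [set t | p^-1%g t \in up_srcs v.+1] [set x | is_ut (w x) && (v < x)]).
have -> : [set x | is_ut (w x) && (v < x)] :&: [set t | p^-1%g t \in up_srcs v.+1]
    = up_open p v.
  apply/setP=> t; rewrite in_setI [RHS]inE 2!inE.
  case pD: (p^-1%g t \in _); rewrite ?andbF //= !andbT.
  by have := utp _ pD; rewrite permKV => ->.
suff -> : [set x | is_ut (w x) && (v < x)] :\: [set t | p^-1%g t \in up_srcs v.+1]
    = p @: [set x | is_us (w x) && (v < x)].
  by rewrite card_imset ?addnK //; apply: perm_inj.
apply/setP=> t; rewrite in_setD 2!inE; apply/andP/imsetP.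
  move=> [nD /andP[utt vt]]; exists (p^-1%g t); last by rewrite permKV.
  have := ap _ nD; rewrite permKV arrow_ut // => /andP[us _].
  by move: nD; rewrite !inE us /= -ltnNge.
move=> [x]; rewrite inE => /andP[us vx] ->.
have nD : x \notin up_srcs v.+1 by rewrite !inE us /= -ltnNge.
have := ap _ nD; rewrite permK arrow_us // => /andP[-> xp]; split=> //.
by rewrite (ltn_trans vx xp).
Qed.

(** Upper arcs starting below [v] are drawn later, so the targets they reach above [v] are the open
    ones other than [p z]: those below [p z] give crossings, those above it nestings. *)
Lemma up_wt_graft p v z s : let D := up_srcs v.+1 in
  v \in D -> z \in D -> v < p z -> ~~ is_lt (w v) ->
  ext w (tperm v z * p)%g (D :\ v) s ->
  up_wt s v = d #|[set t in up_open p v | t < p z]| #|[set t in up_open p v | p z < t]|.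
Proof.
move=> /= vD zD vpz nlt; rewrite ext_graft // => /andP[es /eqP svz].
rewrite /up_wt (negbTE nlt) ucrossE unestE svz.
have opE t : v < t -> (s^-1%g t < v) = (t \in up_open p v) && (t != p z).
  move=> vt; rewrite inE vt -(ext_open _ es) inE ltnS.
  have [aw _] := extP _ _ _ _ es; have := aw (s^-1%g t); rewrite permKV => ast.
  rewrite -svz -(can2_eq (permKV s) (permK s)) (ltn_neqAle (s^-1%g t) v).
  rewrite (inj_eq val_inj); case: eqVneq => [|ne] /=; first by rewrite andbF.
  rewrite andbT; case le: (_ <= v); rewrite ?andbF ?andbT //.
  by have /andP[] := arrow_up ast (leq_ltn_trans le vt).
congr d; apply: eq_card => t; rewrite [LHS]inE [RHS]inE.
  have [vt|] := ltnP v t; last by rewrite inE /= leqNgt => /negbTE->.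
  rewrite (opE _ vt); have [lt|] := ltnP t (p z); last by rewrite andbF.
  by rewrite (_ : t != p z) ?andbT // -(inj_eq val_inj) neq_ltn lt.
rewrite vpz; have [pt|] := ltnP (p z) t; last by rewrite andbF.
rewrite (opE _ (ltn_trans vpz pt)) (_ : t != p z) //.
by rewrite -(inj_eq val_inj) neq_ltn pt orbT.
Qed.

Lemma up_srcsS v : is_us (w v) -> up_srcs v.+1 :\ v = up_srcs v.
Proof.
move=> us; apply/setP=> x; rewrite !inE ltnS -(inj_eq val_inj) (ltn_neqAle x v).
by rewrite andbCA.
Qed.

Lemma up_srcsSn v : ~~ is_us (w v) -> up_srcs v.+1 = up_srcs v.
Proof.
move=> us; apply/setP=> x; rewrite !inE ltnS (ltn_neqAle x v) (inj_eq val_inj).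
by case: eqVneq => [->|//]; rewrite (negbTE us).
Qed.

(* For a cycle valley v, the choice z = v is allowed because v < p v, and it is
   the one closing a cycle; for a cycle double rise it is not, since p v = v. *)
Lemma up_sum m p c0 : m <= N -> valid w p (up_srcs m) ->
  {in up_srcs m, forall x, is_ut (w (p x))} ->
  {in up_srcs m, forall x, if is_lt (w x) then x < p x else p x == x} ->
  cyc p = c0 + #|up_srcs m| ->
  (\sum_(s | ext w p (up_srcs m) s) lam ^+ cyc s * \prod_(v in up_srcs m) up_wt s v
   = lam ^+ c0 * \prod_(v in up_srcs m) up_fac v)%R.
Proof.
elim: m p c0 => [|m IHm] p c0 le_mN vp utp dirp cp.
  have D0 : up_srcs 0 = set0 by apply/setP=> x; rewrite !inE andbF.
  rewrite D0 in vp cp *; case: vp => ap _.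
  rewrite (big_pred1 p); last by move=> s; rewrite /= ext0 // => v; rewrite ap ?inE.
  by rewrite !big_set0 cp cards0 addn0.
pose v := Ordinal le_mN; rewrite -[m]/(v : nat) in vp utp dirp cp IHm *.
have [usv|nus] := boolP (is_us (w v)); last first.
  by rewrite (up_srcsSn nus) in vp utp dirp cp *; apply: IHm => //; apply: ltnW.
have vD : v \in up_srcs v.+1 by rewrite inE usv leqnn.
have arcE z : z \in up_srcs v.+1 -> arrow w v (p z) = (v < p z).
  by move=> zD; rewrite arrow_us // utp.
rewrite (ext_step _ _ _ vD) (eq_bigl (fun z => (z \in up_srcs v.+1) && (v < p z))).
  2: by move=> z /=; case zD: (z \in _) => //=; rewrite arcE.
have cS : #|up_srcs v.+1| = #|up_srcs v|.+1.
  by rewrite (cardsD1 v) vD up_srcsS.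
(* The factor due to the arc of [v] alone; for a valley it only records whether a cycle is
   closed. *)
pose r z : R := if is_lt (w v) then (lam ^+ (v == z))%R else
  d #|[set t in up_open p v | t < p z]| #|[set t in up_open p v | p z < t]|.
transitivity (\sum_(z | (z \in up_srcs v.+1) && (v < p z)%N)
   r z * (lam ^+ c0 * \prod_(x in up_srcs v) up_fac x))%R.
  apply: eq_bigr => z /andP[zD vpz].
  have azv : arrow w v (p z) by rewrite arcE.
  have cyc' := cyc_graft vp vD zD; have vp' := valid_graft vp vD zD azv.
  rewrite (up_srcsS usv) in vp' *.
  have sub x : x \in up_srcs v -> x \in up_srcs v.+1.
    by rewrite -(up_srcsS usv) => /setD1P[].
  have lt_zv : z != v -> z < v.
    by move: zD; rewrite inE ltnS ltn_neqAle (inj_eq val_inj) => /andP[_ ->] ->.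
  have IH := IHm (tperm v z * p)%g (c0 + (v == z)) (ltnW (ltn_ord v)) vp'.
  transitivity (\sum_(s | ext w (tperm v z * p)%g (up_srcs v) s)
      (if is_lt (w v) then 1%R else r z) *
      (lam ^+ cyc s * \prod_(x in up_srcs v) up_wt s x))%R.
    apply: eq_bigr => s es; rewrite (big_setD1 v) //= (up_srcsS usv) mulrCA.
    congr (_ * _)%R; rewrite /r; have [lt|nlt] := boolP (is_lt (w v)).
      by rewrite /up_wt lt.
    by rewrite (@up_wt_graft p v z) // up_srcsS.
  rewrite -mulr_sumr IH.
  - rewrite exprD /r; case: ifP => [lt|nlt]; first by ring.
    suff /negbTE-> : v != z by rewrite nlt expr0 mulr1.
    by apply: contraTneq vpz => <-; have := dirp _ vD; rewrite nlt => /eqP->; rewrite ltnn.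
  - move=> x xD; have [->|nxz] := eqVneq x z; first by rewrite graft_end utp.
    rewrite graft_other ?utp ?sub //.
    by move: xD; rewrite inE => /andP[_ /ltn_eqF]; rewrite -(inj_eq val_inj) => ->.
  (* The end [z] now points to [p v]. If [z] is a valley then [z < v <= p v]; a double rise has
     [p z = z < v] and cannot have been chosen. *)
  - move=> x xD; have nxv : x != v.
      by move: xD; rewrite inE => /andP[_ /ltn_eqF]; rewrite -(inj_eq val_inj) => ->.
    have := dirp _ (sub _ xD).
    have [exz|nxz] := eqVneq x z; last by rewrite graft_other.
    rewrite exz graft_end; have zv : z < v by rewrite lt_zv // -exz.
    case: ifP => [_ _|_ /eqP pz]; last by rewrite pz ltnNge ltnW in vpz.
    have := dirp _ vD; case: ifP => [_|_ /eqP->] //; exact: ltn_trans.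
  - move: cyc'; rewrite cp cS; case: (v == z) => /=; lia.
rewrite -mulr_suml (big_setD1 v vD) up_srcsS // [RHS]mulrCA; congr (_ * _)%R.
have cO := card_up_open vp utp.
have sumO (G : 'I_N -> R) : (\sum_(z | (z \in up_srcs v.+1) && (v < p z)%N) G (p z)
    = \sum_(t in up_open p v) G t)%R.
  rewrite [RHS](reindex_inj (@perm_inj _ p)); apply: eq_bigl => z.
  by rewrite [RHS]inE permK andbC.
rewrite /r /up_fac; case: ifP => [lt|nlt]; last first.
  rewrite (sumO (fun l => d #|[set t in up_open p v | t < l]|
                            #|[set t in up_open p v | l < t]|)).
  by rewrite sum_rank_rev cO.
have vpv : v < p v by have := dirp _ vD; rewrite lt.
(* For a valley, [z = v] contributes [lam] and each other open target contributes 1. *)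
rewrite (bigD1 v) /=; last by rewrite vD.
rewrite eqxx expr1 -addrA; congr (_ + _)%R.
have sum1 : (\sum_(t in up_open p v) 1 = (up_height v)%:R :> R)%R by rewrite sumr_const cO.
have := sumO (fun=> 1%R); rewrite sum1 (bigD1 v) /=; last by rewrite vD.
move=> <-; rewrite [RHS]addrC addKr; apply: eq_bigr => z /andP[_ nzv].
by rewrite eq_sym (negbTE nzv).
Qed.

End UpperArcs.

(** * Drawing the lower arcs *)

Section LowerArcs.
Variables (R : comNzRingType) (lam : R) (b c d : nat -> nat -> R).
Variables (N : nat) (w : 'I_N -> vtype).
Implicit Types (s p : 'S_N) (v x z t : 'I_N) (D : {set 'I_N}).
Local Notation up_fac := (up_fac lam d w).
Local Notation up_wt := (up_wt d w).

(** Lower arcs come first, so every upper source is still undrawn, whatever its position. *)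
Definition low_dom (m : nat) : {set 'I_N} :=
  [set v : 'I_N | is_us (w v) || is_ls (w v) && (m <= v)].

Definition low_height v : nat :=
  #|[set x | is_lt (w x) && (x < v)]| - #|[set x | is_ls (w x) && (x < v)]|.

Definition low_wt s v : R :=
  (if is_lt (w v) then c else b) (lcross s v) (lnest s v).

Definition low_fac v : R :=
  (\sum_(xi < low_height v)
     (if is_lt (w v) then c else b) (low_height v - 1 - xi)%N xi)%R.

Definition low_open p v :=
  [set t : 'I_N | [&& is_lt (w t), t < v & p^-1%g t \in low_dom v]].

Lemma us_ls (y : vtype) : is_us y -> ~~ is_ls y.
Proof. by case: y => [[[] q]|]. Qed.

Lemma ut_lt (y : vtype) : is_ut y -> ~~ is_lt y.
Proof. by case: y => [[u []]|]. Qed.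

Lemma card_low_open p v : valid w p (low_dom v) -> #|low_open p v| = low_height v.
Proof.
move=> [ap _]; rewrite /low_height.
rewrite -(cardsID [set t | p^-1%g t \in low_dom v] [set x | is_lt (w x) && (x < v)]).
have -> : [set x | is_lt (w x) && (x < v)] :&: [set t | p^-1%g t \in low_dom v]
    = low_open p v.
  by apply/setP=> t; rewrite in_setI [RHS]inE 2!inE andbA.
suff -> : [set x | is_lt (w x) && (x < v)] :\: [set t | p^-1%g t \in low_dom v]
    = p @: [set x | is_ls (w x) && (x < v)].
  by rewrite card_imset ?addnK //; apply: perm_inj.
have domN x : is_ls (w x) -> (x \in low_dom v) = (v <= x).
  by move=> ls; rewrite inE ls (contraTF (@us_ls _)).
apply/setP=> t; rewrite in_setD 2!inE; apply/andP/imsetP.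
  move=> [nD /andP[ltt tv]]; exists (p^-1%g t); last by rewrite permKV.
  have := ap _ nD; rewrite permKV arrow_lt // => /andP[ls _].
  by rewrite inE ls ltnNge -domN.
move=> [x]; rewrite inE => /andP[ls xv] ->.
have nD : x \notin low_dom v by rewrite domN // -ltnNge.
have := ap _ nD; rewrite permK arrow_ls // => /andP[-> px]; split=> //.
by rewrite (ltn_trans px xv).
Qed.

Lemma low_domS v : is_ls (w v) -> low_dom v :\ v = low_dom v.+1.
Proof.
move=> ls; apply/setP=> x; rewrite !inE (ltn_neqAle v x) (inj_eq val_inj).
rewrite (eq_sym v); have [->|_] //= := eqVneq x v.
by rewrite andbF orbF (contraTF (@us_ls _)).
Qed.

Lemma low_domSn v : ~~ is_ls (w v) -> low_dom v = low_dom v.+1.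
Proof.
move=> nls; apply/setP=> x; rewrite !inE (ltn_neqAle v x) (inj_eq val_inj).
by case: eqVneq => [<-|//]; rewrite (negbTE nls).
Qed.

(** Mirror image of the upper case: here the open targets above the chosen one give the crossings
    and those below it the nestings. *)
Lemma low_wt_graft p v z s : let D := low_dom v in
  v \in D -> z \in D -> is_ls (w v) -> p z < v ->
  ext w (tperm v z * p)%g (D :\ v) s ->
  low_wt s v = (if is_lt (w v) then c else b)
    #|[set t in low_open p v | p z < t]| #|[set t in low_open p v | t < p z]|.
Proof.
move=> /= vD zD ls pzv; rewrite ext_graft // => /andP[es /eqP svz].
rewrite /low_wt lcrossE lnestE svz.
have opE t : t < v -> (v < s^-1%g t) = (t \in low_open p v) && (t != p z).
  move=> tv; rewrite inE tv -(ext_open _ es).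
  have [aw _] := extP _ _ _ _ es; have := aw (s^-1%g t); rewrite permKV => ast.
  rewrite -svz -(can2_eq (permKV s) (permK s)).
  apply/idP/idP => [vs|/andP[/andP[ltt sD] ne]].
    have /andP[lss ltt] := arrow_down ast (ltn_trans tv vs).
    by rewrite ltt inE lss ltnW //= orbT -(inj_eq val_inj) neq_ltn vs orbT.
  move: ast; rewrite arrow_lt // => /andP[lss _].
  move: sD; rewrite inE lss (contraTF (@us_ls _)) //= => vs.
  by rewrite ltn_neqAle (inj_eq val_inj) eq_sym ne.
congr ((if _ then _ else _) _ _); apply: eq_card => t; rewrite [LHS]inE [RHS]inE.
  have [tv|] := ltnP t v; last by rewrite andbF inE ltnNge => -> /=; rewrite andbF.
  rewrite (opE _ tv); have [lt|] := ltnP (p z) t; last by rewrite andbF.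
  by rewrite (_ : t != p z) ?andbT // -(inj_eq val_inj) neq_ltn lt orbT.
rewrite pzv; have [pt|] := ltnP t (p z); last by rewrite andbF.
rewrite (opE _ (ltn_trans pt pzv)) (_ : t != p z) //.
by rewrite -(inj_eq val_inj) neq_ltn pt.
Qed.

(** Vertices from [m] on are still loops of [p], so a lower arc puts its source in front of a path
    with a smaller end and closes no cycle; [c0] therefore stays fixed. After the last lower arc the
    upper sum takes over. *)
Lemma low_sum m p c0 :
  #|[set x | is_ls (w x)]| = #|[set x | is_lt (w x)]| ->
  m <= N -> valid w p (low_dom m) ->
  (forall x, m <= x -> p x = x) ->
  (forall x, is_us (w x) -> if is_lt (w x) then x <= p x else p x == x) ->
  cyc p = c0 + #|low_dom m| ->
  (\sum_(s | ext w p (low_dom m) s)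
     lam ^+ cyc s * \prod_(v | is_us (w v)) up_wt s v
     * \prod_(v | is_ls (w v) && (m <= v)%N) low_wt s v
   = lam ^+ c0 * \prod_(v | is_us (w v)) up_fac v
     * \prod_(v | is_ls (w v) && (m <= v)%N) low_fac v)%R.
Proof.
move=> bal; move eqn: (N - m) => n; elim: n => [|n IHn] in m eqn p c0 *.
  move=> le_mN vp idp dirp cp.
  have {eqn le_mN} eN : m = N by lia.
  have noN v : (m <= v)%N = false by rewrite eN leqNgt ltn_ord.
  have dE : low_dom m = up_srcs w N.
    by apply/setP=> x; rewrite !inE noN andbF orbF ltn_ord andbT.
  rewrite dE in vp cp *.
  have no1 (f : 'I_N -> R) : (\prod_(v | is_ls (w v) && (m <= v)%N) f v = 1)%R.
    by apply: big_pred0 => v; rewrite noN andbF.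
  rewrite no1 mulr1.
  have usE v : (v \in up_srcs w N) = is_us (w v) by rewrite inE ltn_ord andbT.
  rewrite (eq_bigr (fun s => lam ^+ cyc s * \prod_(v in up_srcs w N) up_wt s v)%R).
    2: by move=> s _; rewrite no1 mulr1 -(eq_bigl _ _ usE).
  rewrite -(eq_bigl _ _ usE); case: (vp) => ap _.
  (* Lower sources and lower targets being equal in number, all lower targets are used up, so the
     remaining open targets are upper ones. *)
  have imp : p @: [set x | is_ls (w x)] = [set x | is_lt (w x)].
    apply/eqP; rewrite eqEcard card_imset ?bal ?leqnn ?andbT; last exact: perm_inj.
    apply/subsetP=> _ /imsetP[x + ->]; rewrite !inE => ls.
    have := ap x; rewrite usE (contraTN (@us_ls _)) // => /(_ isT).
    by rewrite arrow_ls // => /andP[].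
  have utp x : is_us (w x) -> is_ut (w (p x)).
    move=> us; have nlt : ~~ is_lt (w (p x)).
      apply/negP => lt; have : p x \in [set x | is_lt (w x)] by rewrite inE.
      rewrite -imp mem_imset; last exact: perm_inj.
      by rewrite inE (negbTE (us_ls us)).
    case wp: (w (p x)) nlt => [[u []]|] //= _.
    have := ap (p x); rewrite usE wp => /(_ isT); rewrite (arrow_fix _ wp) => /eqP.
    by move/perm_inj => e; rewrite -e in wp; rewrite wp in us.
  apply: up_sum => // x; rewrite usE => us; first exact: utp.
  have := dirp _ us; case: ifP => [lt|//]; rewrite leq_eqVlt => /orP[/eqP/val_inj e|//].
  by have := ut_lt (utp _ us); rewrite -e lt.
move=> le_mN vp idp dirp cp; have lt_mN : m < N by lia.
pose v := Ordinal lt_mN; rewrite -[m]/(v : nat) in le_mN vp idp dirp cp *.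
have {}IHn := IHn v.+1 _.
have [lsv|nls] := boolP (is_ls (w v)); last first.
  rewrite (low_domSn nls) in vp cp *.
  have sE x : is_ls (w x) && (v <= x)%N = is_ls (w x) && (v < x)%N.
    rewrite (ltn_neqAle v x) (inj_eq val_inj); case: eqVneq => [<-|//].
    by rewrite (negbTE nls).
  rewrite (eq_bigr (fun s => lam ^+ cyc s * \prod_(v | is_us (w v)) up_wt s v
     * \prod_(x | is_ls (w x) && (v < x)%N) low_wt s x)%R).
    2: by move=> s _; rewrite (eq_bigl _ _ sE).
  rewrite (eq_bigl _ _ sE); apply: IHn => //; first by rewrite /=; lia.
  by move=> x vx; rewrite idp // ltnW.
have sE x : is_ls (w x) && (v <= x)%N && (x != v) = is_ls (w x) && (v < x)%N.
  by rewrite (ltn_neqAle v x) (inj_eq val_inj) eq_sym -andbA (andbC (_ <= _)%N).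
have lsvv : is_ls (w v) && (v <= v)%N by rewrite lsv /=.
have vD : v \in low_dom v by rewrite inE lsvv orbT.
have pv : p v = v by rewrite idp.
have nusv : ~~ is_us (w v) by apply: contraTN lsv; exact: us_ls.
rewrite (ext_step _ _ _ vD).
have cS : #|low_dom v| = #|low_dom v.+1|.+1 by rewrite (cardsD1 v) vD low_domS.
pose r z : R := (if is_lt (w v) then c else b)
    #|[set t in low_open p v | p z < t]| #|[set t in low_open p v | t < p z]|.
transitivity (\sum_(z | (z \in low_dom v) && arrow w v (p z))
   r z * (lam ^+ c0 * \prod_(v | is_us (w v)) up_fac v
          * \prod_(x | is_ls (w x) && (v < x)%N) low_fac x))%R.
  apply: eq_bigr => z /andP[zD avz].
  have cyc' := cyc_graft vp vD zD; have vp' := valid_graft vp vD zD avz.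
  rewrite (low_domS lsv) in vp' *.
  move: (avz); rewrite arrow_ls // => /andP[ltp pzv].
  (* Vertices at or above [v] are fixed by [p] and cannot satisfy [p z < v]. *)
  have zv : z < v by rewrite ltnNge; apply: contraTN pzv => vz; rewrite idp // -leqNgt.
  have usz : is_us (w z).
    by move: zD; rewrite inE leqNgt zv andbF orbF.
  have ltz : is_lt (w z).
    by have := dirp _ usz; case: ifP => // nlt /eqP pz; rewrite pz nlt in ltp.
  have nvz : v != z by rewrite -(inj_eq val_inj) neq_ltn zv orbT.
  transitivity (\sum_(s | ext w (tperm v z * p)%g (low_dom v.+1) s)
      r z * (lam ^+ cyc s * \prod_(v | is_us (w v)) up_wt s v
          * \prod_(x | is_ls (w x) && (v < x)%N) low_wt s x))%R.
    apply: eq_bigr => s es; rewrite (bigD1 v lsvv) (eq_bigl _ _ sE).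
    by rewrite (@low_wt_graft p v z) ?low_domS // -/(r z) mulrCA.
  rewrite -mulr_sumr (IHn _ _ c0) //.
  - by rewrite /=; lia.
  - move=> x vx; rewrite graft_other ?idp //; first exact: ltnW.
      by rewrite -(inj_eq val_inj) neq_ltn vx orbT.
    by rewrite -(inj_eq val_inj) neq_ltn (ltn_trans zv vx) orbT.
  - move=> x us; have nxv : x != v by apply: contraTneq us => ->.
    have [->|nxz] := eqVneq x z; last by rewrite graft_other ?dirp.
    by rewrite graft_end ltz pv ltnW.
  - by move: cyc'; rewrite cp cS nvz /=; lia.
rewrite -mulr_suml [in RHS](bigD1 v lsvv) (eq_bigl _ _ sE) [RHS]mulrCA.
congr (_ * _)%R; rewrite /low_fac -(card_low_open vp).
(* The arguments are swapped because the crossings of a lower arc count the larger open targets. *)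
rewrite -(sum_rank _ (fun i j => (if is_lt (w v) then c else b) j i)).
rewrite [RHS](reindex_inj (@perm_inj _ p)); apply: eq_bigl => z.
by rewrite [RHS]inE permK arrow_ls // andbC andbA.
Qed.

End LowerArcs.

(** * Heights of the path of types *)

Section Heights.
Variables (N : nat) (w : 'I_N -> vtype).
Implicit Types (v x : 'I_N) (Q : pred 'I_N).

Lemma cards_sum Q : #|[set x | Q x]| = \sum_x (Q x : nat).
Proof. by rewrite -sum1dep_card big_mkcond; apply: eq_bigr => x _; case: (Q x). Qed.

(** A double rise is both an upper source and an upper target, so the two counts differ only by
    valleys and peaks. *)
Lemma card_us_ut Q :
  #|[set x | is_us (w x) && Q x]| + #|[set x | is_peak (w x) && Q x]| =
  #|[set x | is_ut (w x) && Q x]| + #|[set x | is_val (w x) && Q x]|.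
Proof.
rewrite !cards_sum -!big_split; apply: eq_bigr => x _.
by case: (w x) => [[[] []]|] //; case: (Q x).
Qed.

Lemma card_ls_lt Q :
  #|[set x | is_ls (w x) && Q x]| + #|[set x | is_val (w x) && Q x]| =
  #|[set x | is_lt (w x) && Q x]| + #|[set x | is_peak (w x) && Q x]|.
Proof.
rewrite !cards_sum -!big_split; apply: eq_bigr => x _.
by case: (w x) => [[[] []]|] //; case: (Q x).
Qed.

Definition vals_below (m : nat) := #|[set x | is_val (w x) && (x < m)]|.
Definition peaks_below (m : nat) := #|[set x | is_peak (w x) && (x < m)]|.
Definition height v := vals_below v - peaks_below v.
Definition balanced := vals_below N == peaks_below N.

Lemma belowS Q v :
  #|[set x | Q x && (x < v.+1)]| = #|[set x | Q x && (x < v)]| + Q v.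
Proof.
rewrite !cards_sum !(bigD1 v (P := predT)) //= ltnn ltnS leqnn andbT andbF.
rewrite add0n addnC; congr (_ + _); apply: eq_bigr => x nxv.
by rewrite ltnS (ltn_neqAle x) (inj_eq val_inj) nxv.
Qed.

Lemma card_above Q v :
  #|[set x | Q x && (v < x)]| + #|[set x | Q x && (x < v.+1)]| =
  #|[set x | Q x && (x < N)]|.
Proof.
rewrite !cards_sum -big_split; apply: eq_bigr => x _; rewrite ltn_ord andbT ltnS.
by case: (ltnP v x) => _; case: (Q x).
Qed.

Lemma low_heightE v : low_height w v = height v.
Proof.
have := card_ls_lt (fun x => x < v); rewrite /low_height /height /vals_below /peaks_below.
by lia.
Qed.

(** Balance turns counts above [v] into counts up to and including [v], so that a valley itself is
    already counted. *)
Lemma up_heightE v : balanced ->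
  up_height w v = vals_below v.+1 - peaks_below v.+1.
Proof.
move=> /eqP; have := card_us_ut (fun x => v < x); rewrite /up_height.
have := card_above (fun x => is_val (w x)) v.
have := card_above (fun x => is_peak (w x)) v.
by rewrite /vals_below /peaks_below /=; lia.
Qed.

(** Heights are truncated differences; if no peak sits at height 0, the true height never becomes
    negative and truncation is harmless. *)
Lemma motzkin_peaks_le m :
  (forall v, is_peak (w v) -> 0 < height v) -> m <= N -> peaks_below m <= vals_below m.
Proof.
move=> pos; elim: m => [|m IHm] le_mN.
  suff -> : peaks_below 0 = 0 by [].
  by apply: eq_card0 => x; rewrite !inE andbF.
have := IHm (ltnW le_mN); have := pos (Ordinal le_mN).
have := belowS (fun x => is_peak (w x)) (Ordinal le_mN).
have := belowS (fun x => is_val (w x)) (Ordinal le_mN).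
rewrite /height /= -!/(peaks_below _) -!/(vals_below _) => -> ->.
by case: (is_peak _) => [/(_ isT)|_] /=; lia.
Qed.

End Heights.

(** * Pseudo-nestings as heights *)

Section Nestings.
Variables (N : nat) (s : 'S_N).
Implicit Types (v x : 'I_N).

Lemma vtyp_us x : is_us (vtyp s x) = (x < s x).
Proof. by rewrite /vtyp; case: eqP => [->|//]; rewrite ltnn. Qed.

Lemma vtyp_ut x : is_ut (vtyp s x) = (s^-1%g x < x).
Proof.
rewrite /vtyp; case: eqP => [sx|ne] /=.
  by rewrite -[in s^-1%g _]sx permK ltnn.
rewrite -leqNgt leq_eqVlt (inj_eq val_inj) (can2_eq (permKV s) (permK s)).
by case: eqP => // e; case: ne.
Qed.

(** Of the upper arcs starting below [v], none ends at [v] by hypothesis; those ending below [v] are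
    counted by the upper targets there, and the others pass over [v]. *)
Lemma psnest_height v : v <= s^-1%g v ->
  vals_below (vtyp s) v = psnest s v + peaks_below (vtyp s) v.
Proof.
move=> vsv; have := card_us_ut (vtyp s) (fun x => x < v).
have -> : #|[set x | is_us (vtyp s x) && (x < v)]| =
    psnest s v + #|[set x | is_ut (vtyp s x) && (x < v)]|.
  rewrite -(cardsID [set x | v <= s x]); congr (_ + _).
    apply: eq_card => x; rewrite !inE vtyp_us.
    have [xv|] /= := ltnP x v; last by rewrite andbF.
    rewrite andbT (leq_eqVlt v) (inj_eq val_inj); case: eqVneq => [vx|_] /=.
      by rewrite vx permK leqNgt -vx xv in vsv.
    by have [vx|] := ltnP v (s x); rewrite ?andbF // andbT (ltn_trans xv).
  rewrite -(card_imset _ (@perm_inj _ s)); apply: eq_card => t.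
  rewrite [RHS]inE vtyp_ut; apply/imsetP/andP.
    move=> [x]; rewrite !inE vtyp_us -ltnNge => /and3P[sv xs xv] ->.
    by rewrite permK.
  move=> [st tv]; exists (s^-1%g t); last by rewrite permKV.
  by rewrite !inE vtyp_us permKV -ltnNge tv st (ltn_trans st).
by rewrite -addnA -/(vals_below _ _) -/(peaks_below _ _) addnCA => /addnI ->.
Qed.

(** The arcs passing over [v] are split by the position of their target relative to [s v]. With
    [psnest_height], the weight of a valley depends on its height alone. *)
Lemma ucross_unest v : v < s v -> ucross s v + unest s v = psnest s v.
Proof.
move=> vs; rewrite ucrossE unestE -[RHS](card_imset _ (@perm_inj _ s)).
rewrite -[RHS](cardsID [set t : 'I_N | t < s v]); congr (_ + _).
  apply: eq_card => t; rewrite !inE; apply/and3P/andP.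
    move=> [vt ts st]; split=> //; apply/imsetP; exists (s^-1%g t); rewrite ?permKV //.
    by rewrite inE permKV st vt.
  by move=> [/imsetP[x + ->] ts]; rewrite inE permK => /andP[].
apply: eq_card => t; rewrite !inE -leqNgt; apply/and3P/andP.
  move=> [_ ts st]; split; first exact: ltnW.
  apply/imsetP; exists (s^-1%g t); rewrite ?permKV //.
  by rewrite inE permKV st (ltn_trans vs).
move=> [st /imsetP[x + et]]; rewrite inE => /andP[xv vx].
have -> : (s^-1 t)%g = x by rewrite et permK.
split=> //.
rewrite ltn_neqAle st andbT (inj_eq val_inj) et (inj_eq perm_inj).
by apply: contraTneq xv => ->; rewrite ltnn.
Qed.

End Nestings.

Lemma cyc1 N : cyc (1 : 'S_N) = N.
Proof.
rewrite /cyc card_imset ?card_ord // => x y /eqP; rewrite eq_porbit_mem.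
by move=> /porbitP[i ->]; rewrite expg1n perm1.
Qed.

(** * The sum over permutations with given types *)

Section WordSum.
Variables (R : comNzRingType) (lam : R) (a : nat -> R) (b c d g : nat -> nat -> R).
Variables (N : nat).
Implicit Types (s p : 'S_N) (v x z t : 'I_N) (w : 'I_N -> vtype).
Local Open Scope ring_scope.

Definition vwt s v : R :=
  match vtyp s v with
  | None => g v (psnest s v)
  | Some (true, true) => a (ucross s v + unest s v)%N
  | Some (true, false) => d (ucross s v) (unest s v)
  | Some (false, true) => c (lcross s v) (lnest s v)
  | Some (false, false) => b (lcross s v) (lnest s v)
  end.

(** Total weight of the choices at a vertex, powers of [lam] included: a fixed point is a cycle, and
    one of the [h + 1] targets of a valley closes a cycle. *)
Definition step_wt (i : nat) (y : vtype) (h : nat) : R :=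
  match y with
  | None => lam * g i h
  | Some (true, true) => a h * (lam + h%:R)
  | Some (true, false) => \sum_(xi < h) d (h - 1 - xi)%N xi
  | Some (false, true) => \sum_(xi < h) c (h - 1 - xi)%N xi
  | Some (false, false) => \sum_(xi < h) b (h - 1 - xi)%N xi
  end.

Lemma word_sum w :
  \sum_(s : 'S_N | [forall v, vtyp s v == w v]) lam ^+ cyc s * \prod_v vwt s v
  = if balanced w then \prod_(v : 'I_N) step_wt v (w v) (height w v) else 0.
Proof.
have [bal|nbal] := boolP (balanced w); last first.
  (* Upper sources and upper targets of a permutation are equinumerous, so an unbalanced word has no
     permutation. *)
  rewrite big1 // => s /forallP tw; case/negP: nbal.
  have cU : #|[set x | is_us (w x) && (x < N)%N]| = #|[set x | is_ut (w x) && (x < N)%N]|.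
    rewrite -(card_imset [set x | is_us (w x) && _] (@perm_inj _ s)).
    apply: eq_card => t; rewrite [RHS]inE ltn_ord andbT -(eqP (tw t)) vtyp_ut.
    apply/imsetP/idP => [[x + ->]|st].
      by rewrite inE -(eqP (tw x)) vtyp_us ltn_ord andbT permK.
    exists (s^-1 t)%g; last by rewrite permKV.
    by rewrite inE -(eqP (tw _)) vtyp_us ltn_ord andbT permKV.
  have := card_us_ut w (fun x => (x < N)%N); rewrite cU => /addnI.
  by rewrite /balanced /vals_below /peaks_below => ->.
(* [K] collects the weights settled by the word: those of valleys and fixed points, whose statistic
   is the height. *)
pose K v : R := match w v with
  | None => g v (height w v) | Some (true, true) => a (height w v) | _ => 1 end.
have splitW s : [forall v, vtyp s v == w v] -> \prod_v vwt s v =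
    \prod_(v | is_us (w v)) up_wt d w s v
    * \prod_(v | is_ls (w v) && (0 <= v)%N) low_wt b c w s v * \prod_v K v.
  move=> /forallP tw; rewrite [X in _ = X * _ * _]big_mkcond [X in _ = _ * X * _]big_mkcond.
  rewrite -!big_split /=.
  apply: eq_bigr => v _; rewrite /vwt /up_wt /low_wt /K (eqP (tw v)).
  have ht : is_val (w v) || (w v == None) -> psnest s v = height w v.
    move=> tv; rewrite /height.
    have wE P : #|[set x | P (vtyp s x) && (x < v)%N]| = #|[set x | P (w x) && (x < v)%N]|.
      by apply: eq_card => x; rewrite !inE (eqP (tw x)).
    have := @psnest_height _ s v; rewrite /vals_below /peaks_below !wE => -> //.
      by rewrite addnK.
    move: tv; rewrite -(eqP (tw v)) /vtyp; case: eqP => [sv _|_ /=].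
      by rewrite -[in s^-1%g _]sv permK.
    by rewrite /is_val /= orbF => /andP[_ /ltnW].
  have := vtyp_us s v; rewrite (eqP (tw v)).
  case: (w v) ht => [[[] []]|] /= ht; rewrite ?mulr1 ?mul1r ?ht //.
  by move/esym/ucross_unest->; rewrite ht.
under eq_bigr => s tw do rewrite (splitW s tw) !mulrA.
rewrite -mulr_suml.
rewrite (eq_bigl (ext w 1%g (low_dom w 0))); last first.
  move=> s; apply/vtypP/extP => [aw|[]//]; split=> // v.
  rewrite inE perm1 andbT; have := aw v; rewrite /arrow.
  by case: (w v) => [[[] q]|] //; case: (w (s v)) => // /eqP <-.
have fixE v : (v \notin low_dom w 0) = (w v == None).
  by rewrite inE andbT; case: (w v) => [[[] q]|].
(* The construction starts at the identity; the fixed points are the cycles already finished, which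
   gives [c0]. *)
rewrite (@low_sum _ _ _ _ _ _ _ _ _ #|~: low_dom w 0|) //; first last.
- by rewrite cyc1 addnC cardsC card_ord.
- by move=> x; rewrite perm1 leqnn eqxx if_same.
- by move=> x; rewrite perm1.
- split=> [v|]; last by exists id; split=> // x; rewrite perm1.
  by rewrite fixE perm1 => /eqP wv; rewrite arrow_fix.
- have := card_ls_lt w (fun x => (x < N)%N).
  move: bal; rewrite /balanced /vals_below /peaks_below => /eqP-> /addIn.
  have wE (P : pred 'I_N) : #|[set x | P x && (x < N)%N]| = #|[set x | P x]|.
    by apply: eq_card => x; rewrite !inE ltn_ord andbT.
  by rewrite !wE.
(* A peak at height 0 carries an empty sum, so both sides vanish; otherwise the truncated heights
   are the true ones. *)
have [v /andP[pv /eqP hv]|pos] := pickP [pred v | is_peak (w v) && (height w v == 0%N)].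
  have /andP[lsv utv] := pv.
  rewrite [X in _ * X * _](bigD1 v) /= ?lsv // {1}/low_fac low_heightE hv big_ord0.
  rewrite [RHS](bigD1 v) //= hv.
  case: (w v) pv => [[[] []]|] //= _; by rewrite big_ord0 !mul0r mulr0 mul0r.
have {}pos v : is_peak (w v) -> (0 < height w v)%N.
  by move=> pv; have := pos v; rewrite /= pv lt0n => /negbT.
rewrite -prodr_const big_mkcond [X in _ * X * _ * _]big_mkcond.
rewrite [X in _ * _ * X * _]big_mkcond -!big_split; apply: eq_bigr => v _ /=.
rewrite inE fixE andbT /up_fac /low_fac /K low_heightE up_heightE //.
have := belowS (fun x => is_val (w x)) v; have := belowS (fun x => is_peak (w x)) v.
have := motzkin_peaks_le pos (ltnW (ltn_ord v)).
rewrite /height -!/(vals_below w _) -!/(peaks_below w _) => le_pv -> ->.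
case: (w v) => [[[] []]|] /=; rewrite ?addn0 ?mulr1 ?mul1r //.
(* At a valley the upper height is [height w v + 1], which cancels the [- 1] in [up_fac]. *)
by rewrite addn1 subSn // -natr1 addrA addrK mulrC.
Qed.

End WordSum.

(** * Words of types and weighted Motzkin paths *)

Section WordCons.
Variables (T : Type) (n : nat).

Definition word_cons (y : T) (w : {ffun 'I_n -> T}) : {ffun 'I_n.+1 -> T} :=
  [ffun j => oapp w y (unlift ord0 j)].

Lemma word_cons0 y w : word_cons y w ord0 = y.
Proof. by rewrite ffunE unlift_none. Qed.

Lemma word_consS y w k : word_cons y w (lift ord0 k) = w k.
Proof. by rewrite ffunE liftK. Qed.

Lemma word_cons_bij :
  bijective (fun yw : T * {ffun 'I_n -> T} => word_cons yw.1 yw.2).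
Proof.
exists (fun w : {ffun 'I_n.+1 -> T} => (w ord0, [ffun k => w (lift ord0 k)])).
  move=> [y w] /=; rewrite word_cons0; congr pair; apply/ffunP => k.
  by rewrite ffunE word_consS.
move=> w /=; apply/ffunP => j; case: (unliftP ord0 j) => [k ->|->].
  by rewrite word_consS ffunE.
by rewrite word_cons0.
Qed.

End WordCons.

Lemma below_cons (P : pred vtype) n y (w : {ffun 'I_n -> vtype}) m :
  #|[set x | P (word_cons y w x) && (x < m.+1)]| =
  P y + #|[set x | P (w x) && (x < m)]|.
Proof.
rewrite !cards_sum big_ord_recl word_cons0 andbT; congr (_ + _).
by apply: eq_bigr => k _; rewrite word_consS lift0.
Qed.

Lemma below0 n (Q : pred 'I_n) : #|[set x | Q x && (x < 0)]| = 0.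
Proof. by apply: eq_card0 => x; rewrite !inE andbF. Qed.

Section Motzkin.
Variables (R : comNzRingType) (ok : nat -> pred vtype) (wt : nat -> vtype -> nat -> R).
Hypothesis wt0 : forall i y, is_peak y -> wt i y 0 = 0%R.
Local Open Scope ring_scope.

Definition next_height (y : vtype) (h : nat) : nat := (h + is_val y - is_peak y)%N.

(** [i] is the absolute position of the next vertex, kept for the parity conditions, and [n] is the
    number of steps left. *)
Fixpoint motzkin (n i h : nat) : R :=
  if n is n'.+1 then
    \sum_(y : vtype | ok i y) wt i y h * motzkin n' i.+1 (next_height y h)
  else (h == 0%N)%:R.

Lemma motzkin_words n i h :
  \sum_(w : {ffun 'I_n -> vtype} |
      [forall v : 'I_n, ok (i + v)%N (w v)] && (h + vals_below w n == peaks_below w n)%N)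
    \prod_(v : 'I_n) wt (i + v)%N (w v) (h + vals_below w v - peaks_below w v)%N
  = motzkin n i h.
Proof.
elim: n i h => [|n IHn] i h /=.
  have w0 (w : {ffun 'I_0 -> vtype}) : w = [ffun=> None] by apply/ffunP => -[].
  rewrite big_mkcond (big_pred1 [ffun=> None]).
    rewrite big_ord0 /vals_below /peaks_below !below0 addn0.
    by rewrite (_ : [forall v, _]) //; [case: eqP | apply/forallP => -[]].
  by move=> w; rewrite /= [w]w0 eqxx.
rewrite (reindex _ (onW_bij _ (@word_cons_bij _ n))) /=.
transitivity (\sum_(y | ok i y) \sum_(w : {ffun 'I_n -> vtype} |
    [forall v : 'I_n, ok (i.+1 + v)%N (w v)] &&
    (h + (is_val y + vals_below w n) == is_peak y + peaks_below w n)%N)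
  \prod_(v : 'I_n.+1) wt (i + v)%N (word_cons y w v)
     (h + vals_below (word_cons y w) v - peaks_below (word_cons y w) v)%N).
  rewrite pair_big_dep; apply: eq_bigl => -[y w] /=.
  rewrite /vals_below /peaks_below !below_cons andbA.
  congr (_ && _); apply/forallP/andP => [okw|[oky /forallP okw] v].
    split; first by have := okw ord0; rewrite word_cons0 addn0.
    by apply/forallP => v; have := okw (lift ord0 v); rewrite word_consS lift0 addnS.
  case: (unliftP ord0 v) => [k ->|->]; last by rewrite word_cons0 addn0.
  by have := okw k; rewrite word_consS lift0 addnS.
apply: eq_bigr => y oky; rewrite -IHn.
have prodE (w : {ffun 'I_n -> vtype}) :
  \prod_(v : 'I_n.+1) wt (i + v)%N (word_cons y w v)
     (h + vals_below (word_cons y w) v - peaks_below (word_cons y w) v)%N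
  = wt i y h * \prod_(v : 'I_n) wt (i.+1 + v)%N (w v)
     (h + (is_val y + vals_below w v) - (is_peak y + peaks_below w v))%N.
  rewrite big_ord_recl word_cons0 addn0 /vals_below /peaks_below !below0 addn0 subn0.
  congr (_ * _); apply: eq_bigr => v _; rewrite word_consS lift0 addnS.
  by rewrite !below_cons.
(* After a peak at height 0 the truncated heights of the two sides may differ, but the factor of
   that peak is 0. *)
have [/andP[py h0]|legal] := boolP (is_peak y && (h == 0%N)).
  rewrite (eqP h0) wt0 // mul0r big1 // => w _; rewrite -(eqP h0) prodE (eqP h0) wt0 //.
  by rewrite mul0r.
rewrite mulr_sumr; apply: eq_big => [w|w _]; last first.
  rewrite prodE; congr (_ * _); apply: eq_bigr => v _; congr (wt _ _ _).
  by move: legal; rewrite /next_height; case: (is_peak y) => /=; lia.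
congr (_ && _); move: legal; rewrite /next_height.
by case: (is_peak y) => /=; lia.
Qed.

End Motzkin.

Section PermSum.
Variables (R : comNzRingType) (lam : R) (a : nat -> R) (b c d g : nat -> nat -> R).
Variable ok : nat -> pred vtype.
Local Open Scope ring_scope.

Lemma perm_sum N :
  \sum_(s : 'S_N | [forall v : 'I_N, ok v (vtyp s v)])
     lam ^+ cyc s * \prod_(v : 'I_N) vwt a b c d g s v
  = motzkin ok (step_wt lam a b c d g) N 0 0.
Proof.
rewrite -motzkin_words => [|i [[[] []]|] //= _]; last by rewrite big_ord0.
rewrite (partition_big (fun s : 'S_N => [ffun v => vtyp s v])
  (fun w : {ffun 'I_N -> vtype} => [forall v : 'I_N, ok v (w v)])); last first.
  by move=> s /forallP oks; apply/forallP => v; rewrite ffunE.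
rewrite [RHS]big_mkcondr; apply: eq_bigr => w /forallP okw; rewrite add0n.
rewrite -[RHS]/(if balanced w then \prod_(v : 'I_N) step_wt lam a b c d g v (w v) (height w v) else 0).
rewrite -word_sum; apply: eq_bigl => s; apply/andP/forallP => [[_ /eqP <-] v|tw].
  by rewrite ffunE.
split; first by apply/forallP => v; rewrite (eqP (tw v)).
by apply/eqP/ffunP => v; rewrite ffunE (eqP (tw v)).
Qed.

End PermSum.

Lemma sum_vtype (R : nmodType) (F : vtype -> R) :
  (\sum_y F y = F None + F (Some (true, true)) + F (Some (true, false))
    + F (Some (false, true)) + F (Some (false, false)))%R.
Proof.
rewrite (bigD1 None) // (bigD1 (Some (true, true))) // (bigD1 (Some (true, false))) //.
rewrite (bigD1 (Some (false, true))) // (bigD1 (Some (false, false))) //=.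
by rewrite big1 ?addr0 ?addrA // => -[[[] []]|].
Qed.

(** * Statistics of the inverse permutation *)

Section InverseStatistics.
Variables (N : nat) (s : 'S_N).
Implicit Types i j k l : 'I_N.

Lemma eq_invperm i k : (i == s^-1%g k) = (k == s i).
Proof. by rewrite [RHS]eq_sym (can2_eq (permK s) (permKV s)). Qed.

Lemma lcross'V : lcross' s^-1%g =1 ucross s.
Proof.
move=> j; apply: eq_card => t; rewrite !inE /lower_cross /upper_cross.
by rewrite !eq_invperm.
Qed.

Lemma lnest'V : lnest' s^-1%g =1 unest s.
Proof.
move=> j; apply: eq_card => t; rewrite !inE /lower_nest /upper_nest.
by rewrite !eq_invperm [X in [&& _, _, _ & X]]andbC.
Qed.

Lemma ucross'V : ucross' s^-1%g =1 lcross s.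
Proof.
move=> j; apply: eq_card => t; rewrite !inE /lower_cross /upper_cross.
by rewrite !eq_invperm.
Qed.

Lemma unest'V : unest' s^-1%g =1 lnest s.
Proof.
move=> j; apply: eq_card => t; rewrite !inE /lower_nest /upper_nest.
by rewrite !eq_invperm [X in [&& _, _, _ & X]]andbC.
Qed.

(** At a fixed point the statistic is the height, and inversion preserves valleys and peaks. *)
Lemma psnestV i : s i = i -> psnest s^-1%g i = psnest s i.
Proof.
move=> si; have sVi : s^-1%g i = i by rewrite -[in LHS]si permK.
have := @psnest_height _ s i; rewrite sVi leqnn => /(_ isT).
have := @psnest_height _ s^-1%g i; rewrite invgK si leqnn => /(_ isT).
have tE x : (is_val (vtyp s^-1%g x) = is_val (vtyp s x)) *
            (is_peak (vtyp s^-1%g x) = is_peak (vtyp s x)).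
  rewrite /vtyp invgK -(inj_eq (@perm_inj _ s) _ x) permKV eq_sym.
  by case: eqP => _ //; case: (x < s x); case: (x < s^-1%g x).
have -> : vals_below (vtyp s^-1%g) i = vals_below (vtyp s) i.
  by apply: eq_card => x; rewrite !inE tE.
have -> : peaks_below (vtyp s^-1%g) i = peaks_below (vtyp s) i.
  by apply: eq_card => x; rewrite !inE tE.
by move=> -> /addIn.
Qed.

End InverseStatistics.

(** * D-permutations as Motzkin paths *)

Section Weights.
Variables (R : comNzRingType) (lam : R) (a : nat -> R).
Variables (b c d : nat -> nat -> R) (e f : nat -> R).
Local Open Scope ring_scope.

Definition fix_wt (i h : nat) : R := (if odd i.+1 then f else e) h.

Definition ok_Q (i : nat) (y : vtype) : bool :=
  if odd i.+1 then ~~ is_ls y else ~~ is_us y.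

(** The D-permutation condition for the inverse, hence on targets instead of sources. *)
Definition ok_Q' (i : nat) (y : vtype) : bool :=
  if odd i.+1 then ~~ is_ut y else ~~ is_lt y.

Lemma Dperm_types n (s : 'S_(2 * n)) :
  (s \in Dperm n) = [forall v : 'I_(2 * n), ok_Q v (vtyp s v)].
Proof.
rewrite inE; apply: eq_forallb => v; rewrite /ok_Q vtyp_us -leqNgt.
suff -> : is_ls (vtyp s v) = (s v < v)%N by rewrite -leqNgt.
rewrite /vtyp; case: eqP => [->|/eqP ne] /=; first by rewrite ltnn.
by rewrite (ord_neq_ltn ne).
Qed.

Lemma Dperm_types' n (s : 'S_(2 * n)) :
  (s^-1%g \in Dperm n) = [forall v : 'I_(2 * n), ok_Q' v (vtyp s v)].
Proof.
rewrite inE; apply: eq_forallb => v; rewrite /ok_Q' vtyp_ut -leqNgt.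
suff -> : is_lt (vtyp s v) = (v < s^-1%g v)%N by rewrite -leqNgt.
rewrite /vtyp; case: eqP => [sv|//] /=.
by rewrite -[in s^-1%g _]sv permK ltnn.
Qed.

Lemma prod_types N (s : 'S_N) (Fa Fb Fc Fd Fe Ff : 'I_N -> R) :
  \prod_(i in Cval s) Fa i * \prod_(i in Cpeak s) Fb i
  * \prod_(i in Cdfall s) Fc i * \prod_(i in Cdrise s) Fd i
  * \prod_(i in Evenfix s) Fe i * \prod_(i in Oddfix s) Ff i
  = \prod_i match vtyp s i with
     | None => if odd i.+1 then Ff i else Fe i
     | Some (true, true) => Fa i
     | Some (true, false) => Fd i
     | Some (false, true) => Fc i
     | Some (false, false) => Fb i
     end.
Proof.
rewrite !(big_mkcond (fun i => i \in _)) -!big_split; apply: eq_bigr => i _ /=.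
rewrite !inE /label /vtyp; have [si|ne] := eqVneq (s i) i.
  have -> : s^-1%g i = i by rewrite -[in LHS]si permK.
  by rewrite si !ltnn /=; case: (odd i) => /=; rewrite !(mul1r, mulr1).
have neV : s^-1%g i != i by rewrite (can2_eq (permKV s) (permK s)) eq_sym.
rewrite (ord_neq_ltn ne) (ord_neq_ltn neV).
by case: (i < s i)%N; case: (i < s^-1%g i)%N; rewrite /= !(mul1r, mulr1).
Qed.

Lemma Qhat_motzkin n :
  Qhat lam a b c d e f n =
  motzkin ok_Q (step_wt lam a b c d fix_wt) (2 * n) 0 0.
Proof.
rewrite -perm_sum /Qhat; apply: eq_big => [s|s _]; first exact: Dperm_types.
rewrite -!mulrA; congr (_ * _); rewrite !mulrA prod_types; apply: eq_bigr => i _.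
by rewrite /vwt /fix_wt; case: (odd i.+1).
Qed.

(** Reindexing by inversion turns the primed statistics into unprimed ones and exchanges double
    rises with double falls, hence [c] with [d]. *)
Lemma Qhat'_motzkin n :
  Qhat' lam a b c d e f n =
  motzkin ok_Q' (step_wt lam a b d c fix_wt) (2 * n) 0 0.
Proof.
rewrite -perm_sum /Qhat' (reindex_inj invg_inj) /=.
apply: eq_big => [s|s _]; first exact: Dperm_types'.
rewrite /cyc porbitsV -!mulrA; congr (_ * _); rewrite !mulrA.
rewrite prod_types; apply: eq_bigr => i _.
rewrite lcross'V lnest'V ucross'V unest'V /vwt /fix_wt /vtyp.
rewrite invgK eq_sym -(can2_eq (permK s) (permKV s)).
have [si|_] := eqVneq (s i) i; first by rewrite psnestV //; case: (odd i.+1).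
by case: (i < s i)%N; case: (i < s^-1%g i)%N.
Qed.

End Weights.

(** * Formal power series and T-fractions *)

Section PowerSeries.
Variable R : comNzRingType.
Implicit Types f g h : nat -> R.
Local Open Scope ring_scope.

(** A coefficient of a product involves finitely many coefficients, so the ring laws are inherited
    from truncated polynomials. *)
Lemma fps_mulE f g n m : (n <= m)%N ->
  fps_mul f g n = ((\poly_(i < m.+1) f i) * (\poly_(i < m.+1) g i))`_n.
Proof.
move=> le_nm; rewrite coefM; apply: eq_bigr => i _.
have le_im : (i <= m)%N by apply: leq_trans le_nm; rewrite -ltnS.
by rewrite !coef_poly !ltnS le_im (leq_trans (leq_subr _ _) le_nm).
Qed.

Lemma fps_mulC f g n : fps_mul f g n = fps_mul g f n.
Proof. by rewrite !(fps_mulE _ _ (leqnn n)) mulrC. Qed.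

Lemma eq_fps_mul f f' g g' n :
  (forall i, (i <= n)%N -> f i = f' i) -> (forall i, (i <= n)%N -> g i = g' i) ->
  fps_mul f g n = fps_mul f' g' n.
Proof.
move=> ef eg; apply: eq_bigr => i _; rewrite ef ?eg ?leq_subr //.
by rewrite -ltnS.
Qed.

Lemma fps_mulA f g h n :
  fps_mul f (fps_mul g h) n = fps_mul (fps_mul f g) h n.
Proof.
rewrite !(fps_mulE _ _ (leqnn n)).
set pf := \poly_(i < n.+1) f i; set pg := \poly_(i < n.+1) g i.
set ph := \poly_(i < n.+1) h i.
transitivity ((pf * (pg * ph))`_n); last rewrite mulrA; rewrite !coefM.
  apply: eq_bigr => i _; congr (_ * _).
  by rewrite coef_poly ltnS leq_subr (fps_mulE _ _ (leq_subr i n)).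
apply: eq_bigr => i _; congr (_ * _); have le_in : (i <= n)%N by rewrite -ltnS.
by rewrite coef_poly ltnS le_in (fps_mulE _ _ le_in).
Qed.

Lemma fps_mul1 f n : fps_mul (fun i => (i == 0%N)%:R) f n = f n.
Proof.
rewrite /fps_mul big_ord_recl subn0 mul1r big1 ?addr0 // => i _.
by rewrite mul0r.
Qed.

(** The hypothesis stops at index [n] because identities for truncated fractions hold only for low
    coefficients. *)
Lemma fps_div f X Y n : f 0%N = 1 ->
  (forall i, (i <= n)%N -> fps_mul f X i = Y i) -> X n = fps_mul (fps_inv f) Y n.
Proof.
move=> f0 fX; rewrite -(fps_mul1 X).
transitivity (fps_mul (fps_mul (fps_inv f) f) X n).
  by apply: eq_fps_mul => // i _; rewrite fps_mulC fps_mulV.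
by rewrite -fps_mulA; apply: eq_fps_mul.
Qed.

Lemma fps_mulr1 f n : fps_mul f (fun i => (i == 0%N)%:R) n = f n.
Proof. by rewrite fps_mulC fps_mul1. Qed.

Lemma fps_mulXl f g n : fps_mul (fps_mulX f) g n = fps_mulX (fps_mul f g) n.
Proof.
case: n => [|n]; first by rewrite /fps_mul big_ord1 mul0r.
by rewrite /fps_mul big_ord_recl mul0r add0r; apply: eq_bigr.
Qed.

Lemma fps_mulXr f g n : fps_mul f (fps_mulX g) n = fps_mulX (fps_mul f g) n.
Proof.
by rewrite fps_mulC fps_mulXl; case: n => //= n; rewrite fps_mulC.
Qed.

Lemma fps_mulZr k f g n : fps_mul f (fun i => k * g i) n = k * fps_mul f g n.
Proof. by rewrite /fps_mul mulr_sumr; apply: eq_bigr => i _; rewrite mulrCA. Qed.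

Lemma fps_mul_den (dl al : R) T X n :
  fps_mul (fun i => (i == 0%N)%:R - dl * (i == 1%N)%:R - al * fps_mulX T i) X n
  = X n - dl * fps_mulX X n - al * fps_mulX (fps_mul T X) n.
Proof.
rewrite -fps_mulXl -{1}(fps_mul1 X) /fps_mul.
have -> : fps_mulX X n = \sum_(i < n.+1) ((i : nat) == 1%N)%:R * X (n - i)%N.
  case: n => [|n]; first by rewrite big_ord1 mul0r.
  rewrite big_ord_recl mul0r add0r big_ord_recl mul1r /= subSS subn0.
  by rewrite big1 ?addr0 // => i _; rewrite mul0r.
rewrite !mulr_sumr -!sumrB; apply: eq_bigr => i _; ring.
Qed.

(* [V k] and [W k] count the path suffixes starting at height k in front of an
   odd, resp. even, vertex and ending at height 0; t marks the even vertices. *)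
Section PathTransfer.
Variables (A B E F : nat -> R) (V W : nat -> nat -> R) (delta alpha : nat -> R).
Hypotheses
  (V0 : forall k, V k 0%N = (k == 0%N)%:R)
  (VS : forall k n, V k n.+1 = F k * W k n.+1 + A k * W k.+1 n.+1)
  (W0 : forall k, W k 0%N = 0)
  (W0S : forall n, W 0%N n.+1 = E 0%N * V 0%N n)
  (WSS : forall k n, W k.+1 n.+1 = E k.+1 * V k.+1 n + B k.+1 * V k n)
  (alpha_odd : forall k, alpha (2 * k).+1 = A k * B k.+1)
  (alpha_even : forall k, alpha (2 * k.+1)%N = E k.+1 * F k.+1)
  (delta1 : delta 1%N = E 0%N * F 0%N)
  (delta_ge2 : forall m, (2 <= m)%N -> delta m = 0).

(** Only even vertices lower the path, by one unit each, so descending from height [k] takes at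
    least [k] of them. *)
Lemma path_low k n : (n < k)%N -> V k n = 0 /\ W k n = 0.
Proof.
have W_of_V m : (forall j, (m < j)%N -> V j m = 0) ->
    forall j, (m.+1 < j)%N -> W j m.+1 = 0.
  move=> Vm [//|j] mj; rewrite WSS !Vm ?mulr0 ?addr0 //; exact: ltnW.
suff VW m : (forall j, (m < j)%N -> V j m = 0) /\ (forall j, (m < j)%N -> W j m = 0).
  by move=> nk; have [-> // ->] := VW n.
elim: m => [|m [Vm Wm]].
  by split=> [[|j]|j] //; rewrite ?V0.
have Wm1 := W_of_V m Vm; split=> // j mj.
by rewrite VS !Wm1 ?mulr0 ?addr0 //; apply: ltnW.
Qed.

Local Notation T := (Tfrac_trunc delta alpha).

(* The T-fraction started at level 2k, resp. 2k + 1, is the ratio of W_k and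
   t B_k V_(k-1), resp. of V_k and F_k W_k. *)
Lemma trunc_paths K :
  (forall k n, (2 * n < 2 * k.+1 + K)%N ->
     W k.+1 n = B k.+1 * fps_mulX (fps_mul (T K (2 * k.+1)) (V k)) n) /\
  (forall k n, (2 * n < 2 * k.+1 + K)%N ->
     V k.+1 n = F k.+1 * fps_mul (T K (2 * k.+1).+1) (W k.+1) n).
Proof.
elim: K => [|K [IHW IHV]].
  (* For [K = 0] the truncation is 0, and the bound leaves only coefficients covered by
     [path_low]. *)
  split=> k n nk.
    have [_ ->] : V k.+1 n = 0 /\ W k.+1 n = 0 by apply: path_low; lia.
    case: n {nk} => [|n] /=; first by rewrite mulr0.
    by rewrite /fps_mul big1 ?mulr0 // => i _; rewrite mul0r.
  have [-> _] : V k.+1 n = 0 /\ W k.+1 n = 0 by apply: path_low; lia.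
  by rewrite /fps_mul big1 ?mulr0 // => i _; rewrite mul0r.
split=> k n nk.
  have d0 : delta (2 * k.+1) = 0 by apply: delta_ge2; lia.
  rewrite -fps_mulXr -fps_mulZr; apply: fps_div.
    by rewrite d0 mul0r /= mulr0 !subr0.
  move=> i le_in; rewrite fps_mul_den d0 mul0r subr0.
  rewrite alpha_even; case: i le_in => [|i] le_in; first by rewrite W0 /= !mulr0 subr0.
  (* By induction the [alpha] term equals [t E_(k+1) V_(k+1)]; removing it from [W_(k+1)] leaves
     [t B_(k+1) V_k]. *)
  by rewrite /= WSS IHV; [ring | lia].
have d0 : delta (2 * k.+1).+1 = 0 by apply: delta_ge2; lia.
rewrite -fps_mulZr; apply: fps_div.
  by rewrite d0 mul0r /= mulr0 !subr0.
move=> i le_in; rewrite fps_mul_den d0 mul0r subr0.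
rewrite alpha_odd; case: i le_in => [|i] le_in; first by rewrite V0 W0 /= !mulr0 subr0.
have -> : (2 * k.+1).+2 = (2 * k.+2)%N by lia.
(* Here the [alpha] term equals [A_(k+1) W_(k+2)]; removing it from [V_(k+1)] leaves
   [F_(k+1) W_(k+1)]. *)
by rewrite VS (IHW k.+1) /=; [ring | lia].
Qed.

(** The first denominator times [V_0] must be 1. At height 0 no fall is possible, so
    [W_0 = t E_0 V_0]; the resulting level pair of steps, of weight [E_0 F_0], is the source of
    [delta 1]. *)
Lemma paths_Tfrac : is_Tfrac delta alpha (V 0%N).
Proof.
move=> n; exists (2 * n).+1 => -[//|K] leK.
rewrite /= -[LHS]fps_mulr1.
apply/esym/fps_div; first by rewrite /= !mulr0 !subr0.
move=> i le_in; rewrite fps_mul_den; case: i le_in => [|i] le_in.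
  by rewrite V0 /= !mulr0 !subr0.
have := @trunc_paths K; rewrite (alpha_odd 0) delta1 VS W0S => -[IHW _].
by rewrite (IHW 0%N i.+1) /=; [rewrite muln1; ring | lia].
Qed.

End PathTransfer.
End PowerSeries.

(** * Motzkin paths with steps of period two *)

Section Periodic.
Variables (R : comNzRingType) (ok : nat -> pred vtype) (wt : nat -> vtype -> nat -> R).
Variables (A B E F : nat -> R) (delta alpha : nat -> R).
Local Open Scope ring_scope.
Hypotheses
  (ok_per : forall i, ok i.+2 =1 ok i) (wt_per : forall i y h, wt i.+2 y h = wt i y h)
  (M0 : forall n h, motzkin ok wt n.+1 0 h =
     F h * motzkin ok wt n 1 h + A h * motzkin ok wt n 1 h.+1)
  (M1 : forall n h, motzkin ok wt n.+1 1 h =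
     E h * motzkin ok wt n 2 h + B h * motzkin ok wt n 2 h.-1)
  (B0 : B 0%N = 0)
  (alpha_odd : forall k, alpha (2 * k).+1 = A k * B k.+1)
  (alpha_even : forall k, alpha (2 * k.+1)%N = E k.+1 * F k.+1)
  (delta1 : delta 1%N = E 0%N * F 0%N)
  (delta_ge2 : forall m, (2 <= m)%N -> delta m = 0).

Lemma motzkin_periodic n i h : motzkin ok wt n i.+2 h = motzkin ok wt n i h.
Proof.
elim: n i h => //= n IHn i h.
by apply: eq_big => [y|y _]; rewrite ?ok_per // wt_per IHn.
Qed.

Lemma motzkin_Tfrac :
  is_Tfrac delta alpha (fun n => motzkin ok wt (2 * n) 0 0).
Proof.
pose V k n := motzkin ok wt (2 * n) 0 k.
(* A suffix in front of an even vertex has odd length and one more even vertex than odd ones, so its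
   coefficient 0 vanishes. *)
pose W k n := if n is n'.+1 then motzkin ok wt (2 * n').+1 1 k else 0.
have V2 k n : V k n = motzkin ok wt (2 * n) 2 k by rewrite motzkin_periodic.
apply: (paths_Tfrac (V := V) (W := W) (A := A) (B := B) (E := E) (F := F)) => //.
- by move=> k n; rewrite /V mulnS M0.
(* At height 0 the default value of [h.-1] is cancelled by [B 0 = 0]. *)
- by move=> n; rewrite /W M1 -V2 B0 mul0r addr0.
- by move=> k n; rewrite /W M1 -!V2.
Qed.

End Periodic.

Lemma eq_Tfrac (R : comNzRingType) (delta alpha f g : nat -> R) :
  f =1 g -> is_Tfrac delta alpha f -> is_Tfrac delta alpha g.
Proof.
by move=> fg Tf n; have [K0 TK] := Tf n; exists K0 => K /TK; rewrite -fg.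
Qed.

Lemma Tfrac_unique (R : comNzRingType) (delta alpha f g : nat -> R) :
  is_Tfrac delta alpha f -> is_Tfrac delta alpha g -> f =1 g.
Proof.
move=> Tf Tg n; have [Kf TKf] := Tf n; have [Kg TKg] := Tg n.
by rewrite -(TKf (maxn Kf Kg)) ?leq_maxl // TKg ?leq_maxr.
Qed.

Local Open Scope ring_scope.

Theorem theorem4p7 (R : comNzRingType) (lam : R) (a : nat -> R)
    (b c d : nat -> nat -> R) (e f : nat -> R) (alpha delta : nat -> R)
    (alpha_odd : forall k : nat, (1 <= k)%N ->
       alpha (2 * k - 1)%N =
         (lam + k%:R - 1) * a (k - 1)%N * \sum_(xi < k) b (k - 1 - xi)%N xi)
    (alpha_even : forall k : nat, (1 <= k)%N ->
       alpha (2 * k)%N =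
         (lam * e k + \sum_(xi < k) c (k - 1 - xi)%N xi)
         * (lam * f k + \sum_(xi < k) d (k - 1 - xi)%N xi))
    (delta1 : delta 1%N = lam ^+ 2 * e 0%N * f 0%N)
    (delta_ge2 : forall n : nat, (2 <= n)%N -> delta n = 0) :
  [/\ is_Tfrac delta alpha (Qhat' lam a b c d e f),
      is_Tfrac delta alpha (Qhat lam a b c d e f)
    & forall n : nat, Qhat' lam a b c d e f n = Qhat lam a b c d e f n].
Proof.
(* Total step weights: an odd vertex rises with [A] or stays level with [F]; an even vertex falls
   with [B] or stays level with [E]. *)
pose A k := a k * (lam + k%:R).
pose B k := \sum_(xi < k) b (k - 1 - xi)%N xi.
pose E k := lam * e k + \sum_(xi < k) c (k - 1 - xi)%N xi.
pose F k := lam * f k + \sum_(xi < k) d (k - 1 - xi)%N xi.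
have B0 : B 0%N = 0 by rewrite /B big_ord0.
have Ao k : alpha (2 * k).+1 = A k * B k.+1.
  have -> : (2 * k).+1 = (2 * k.+1 - 1)%N by lia.
  rewrite alpha_odd // /A /B subn1 /= -natr1 addrA addrK.
  by rewrite [a k * _]mulrC.
have Ae k : alpha (2 * k.+1)%N = E k.+1 * F k.+1 by rewrite alpha_even.
have d1 : delta 1%N = E 0%N * F 0%N.
  by rewrite delta1 /E /F !big_ord0 !addr0; ring.
have TQ : is_Tfrac delta alpha (Qhat lam a b c d e f).
  apply: eq_Tfrac (fun n => esym (Qhat_motzkin lam a b c d e f n)) _.
  apply: (motzkin_Tfrac (A := A) (B := B) (E := E) (F := F)) => //.
  - by move=> i y; rewrite /ok_Q /= negbK.
  - by move=> i [[[] []]|] h //=; rewrite /fix_wt /= negbK.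
  - move=> n h /=; rewrite big_mkcond sum_vtype /ok_Q /= !addr0 /F /A.
    rewrite -[fix_wt e f 0 h]/(f h).
    by rewrite /next_height /= !addn0 subn0 addn1 subn0; ring.
  - move=> n h /=; rewrite big_mkcond sum_vtype /ok_Q /= !addr0 /E /B.
    rewrite -[fix_wt e f 1 h]/(e h).
    by rewrite /next_height /= !addn0 subn0 subn1; ring.
(* Apart from fixed points, the level steps are now double falls at odd vertices and double rises at
   even ones; exchanging [c] and [d] restores the same totals. *)
have TQ' : is_Tfrac delta alpha (Qhat' lam a b c d e f).
  apply: eq_Tfrac (fun n => esym (Qhat'_motzkin lam a b c d e f n)) _.
  apply: (motzkin_Tfrac (A := A) (B := B) (E := E) (F := F)) => //.
  - by move=> i y; rewrite /ok_Q' /= negbK.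
  - by move=> i [[[] []]|] h //=; rewrite /fix_wt /= negbK.
  - move=> n h /=; rewrite big_mkcond sum_vtype /ok_Q' /= !addr0 /F /A.
    rewrite -[fix_wt e f 0 h]/(f h).
    by rewrite /next_height /= !addn0 subn0 addn1 subn0; ring.
  - move=> n h /=; rewrite big_mkcond sum_vtype /ok_Q' /= !addr0 /E /B.
    rewrite -[fix_wt e f 1 h]/(e h).
    by rewrite /next_height /= !addn0 subn0 subn1; ring.
by split=> // n; apply: Tfrac_unique TQ' TQ n.
Qed.
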